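(* Let $(X,d,\mu)$ be a quasiconvex uniform visual Gromov hyperbolic metric measure space (Gromov hyperbolicity being defined using the Gromov product). If $(X,d,\mu)$ supports a local weak $(1,1)$-Poincar\'e inequality and its Gromov boundary $\partial X$ is connected and contains at least two points, then $(X,d,\mu)$ satisfies $(S_{1,1})$.
   Context: A metric measure space $(X,d,\mu)$ is a metric space $(X,d)$ with a Borel regular outer measure $\mu$ such that $\mu(X)>0$ and $\mu(B(x,r))<\infty$ for all $x\in X$, $r>0$; $B(x,r)$ denotes the open ball. It is quasiconvex if there is $Q\ge 1$ such that any $x,y\in X$ are joined by a rectifiable path of length at most $Q\,d(x,y)$. It is uniform if there are non-decreasing functions $f,g\colon(0,\infty)\to(0,\infty)$ with $f(r)\le\mu(B(x,r))\le g(r)$ for all $x\in X$ and $0<r<\infty$. Upper gradients: a Borel function $g\colon X\to[0,\infty]$ is an upper gradient of $u$ if $|u(\gamma(a))-u(\gamma(b))|\le\int_\gamma g\,ds$ for every rectifiable path $\gamma\colon[a,b]\to X$, and a $1$-weak upper gradient if this holds for all rectifiable paths outside a family of $1$-modulus zero. $N^{1,1}(X,d,\mu)$ is the Newton-Sobolev space of (equivalence classes of) integrable functions $u\colon X\to[-\infty,\infty]$ having an integrable upper gradient, and $|\nabla u|$ is the minimal $1$-weak upper gradient of $u$. The space supports a local weak $(1,1)$-Poincar\'e inequality (up to scale $R_P$) if there are $C_P,R_P>0$ and $\tau\ge1$ such that for all balls $B(x,r)\subseteq X$ with $0<r\le R_P$ one has $0<\mu(B(x,\tau r))<\infty$ and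 $$\frac1{\mu(B(x,r))}\int_{B(x,r)}|u-u_{B(x,r)}|\,d\mu\le C_P\,r\,\frac1{\mu(B(x,\tau r))}\int_{B(x,\tau r)}g_u\,d\mu$$ for every $u\colon X\to\mathbb R$ with $u\in L^1(B(x,\tau r),d,\mu)$, where $g_u\colon X\to[0,\infty]$ is its minimal $1$-weak upper gradient and $u_A=\frac1{\mu(A)}\int_A u\,d\mu$. $(X,d,\mu)$ satisfies $(S_{1,1})$ if there exists $C>0$ such that $\int_X|u|\,d\mu\le C\int_X|\nabla u|\,d\mu$ for every $u\in N^{1,1}(X,d,\mu)$ with bounded support. Gromov hyperbolicity: the Gromov product is $(x|y)_o=\frac12(d(x,o)+d(y,o)-d(x,y))$; $X$ is Gromov hyperbolic if for some $\delta\ge0$, $(x|z)_o\ge\min\{(x|y)_o,(y|z)_o\}-\delta$ for all $x,y,z,o\in X$. Fix $o\in X$. The Gromov boundary $\partial X$ is the set of classes of sequences $(x_i)$ in $X$ with $(x_i|x_j)_o\to\infty$ as $i,j\to\infty$, where $(x_i)\sim(y_i)$ if $(x_i|y_i)_o\to\infty$. For $\xi,\eta\in\partial X$ and $x\in X$ put $(\xi|\eta)_o=\inf\liminf_i(x_i|y_i)_o$ and $(x|\xi)_o=\inf\liminf_i(x|x_i)_o$, the infima over $(x_i)\in\xi$, $(y_i)\in\eta$. Topology on $\partial X$: $U\subseteq\partial X$ is open iff for every $\xi\in U$ there is $r>0$ with $\{\eta\in\partial X:(\xi|\eta)_o>r\}\subseteq U$. $X$ is visual if there are $o\in X$ and $D>0$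 such that for each $x\in X$ there is $\xi\in\partial X$ with $d(o,x)\le(x|\xi)_o+D$. *)

(* Defs.v *)
From HB Require Import structures.
From mathcomp Require Import all_boot all_order all_algebra.
From mathcomp Require Import all_classical all_reals all_analysis.
From mathcomp Require Import measurable_realfun.

Set Implicit Arguments.
Unset Strict Implicit.
Unset Printing Implicit Defensive.
Import Order.TTheory GRing.Theory Num.Theory.
Import numFieldNormedType.Exports.

Local Open Scope classical_set_scope.
Local Open Scope ring_scope.

(* The library's measurable types are pointed.  A space of positive measure is
   nonempty, so asking for a distinguished point loses no generality; the point
   itself is never used below. *)
#[short(type="pmetricType")]
HB.structure Definition PointedMetric (K : numDomainType) :=
  {M of Metric K M & isPointed M}.

Section metric_measure_space.
Context {R : realType} {X : pmetricType R}.

Local Notation borel_type := (g_sigma_algebraType (@open X)).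

Definition borel_set (A : set X) : Prop := measurable (A : set borel_type).

Definition borel_fun (g : X -> \bar R) : Prop :=
  measurable_fun [set: borel_type] (g : borel_type -> \bar R).

Definition borel_regular (mu : {outer_measure set X -> \bar R}) : Prop :=
  borel_set `<=` mu.-caratheodory /\
  forall A : set X, exists B, [/\ borel_set B, A `<=` B & mu B = mu A].

Definition metric_measure_space (mu : {outer_measure set X -> \bar R}) : Prop :=
  [/\ borel_regular mu, (0 < mu [set: X])%E &
      forall (x : X) (r : R), 0 < r -> (mu (ball x r) < +oo)%E].

(* Integrals with respect to an outer measure are taken on the sigma-algebra of
   its Caratheodory-measurable sets. *)
Definition ointegral (mu : {outer_measure set X -> \bar R}) (A : set X)
    (f : X -> \bar R) : \bar R :=
  (\int[(mu : set (caratheodory_type mu) -> \bar R)]_(x in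
     (A : set (caratheodory_type mu))) f x)%E.

Definition ointegrable (mu : {outer_measure set X -> \bar R}) (A : set X)
    (f : X -> \bar R) : Prop :=
  (mu : set (caratheodory_type mu) -> \bar R).-integrable
     (A : set (caratheodory_type mu)) f.

Definition average (mu : {outer_measure set X -> \bar R}) (A : set X)
    (f : X -> \bar R) : \bar R :=
  ((fine (mu A))^-1%:E * ointegral mu A f)%E.

Definition uniform_space (mu : {outer_measure set X -> \bar R}) : Prop :=
  exists f g : R -> R,
    [/\ forall r, 0 < r -> 0 < f r /\ 0 < g r,
        forall r s, 0 < r -> r <= s -> f r <= f s /\ g r <= g s &
        forall (x : X) r, 0 < r ->
          ((f r)%:E <= mu (ball x r))%E /\ (mu (ball x r) <= (g r)%:E)%E].

Definition path_length (a b : R) (c : R -> X) : \bar R :=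
  ereal_sup [set (\sum_(0 <= i < size s)
                   mdist (c (nth b (a :: s) i)) (c (nth b (a :: s) i.+1)))%:E
            | s in itv_partition a b].

Record rpath := RPath {
  lo : R;
  hi : R;
  rfun :> R -> X;
  _ : lo <= hi;
  _ : {within `[lo, hi], continuous rfun};
  _ : (path_length lo hi rfun < +oo)%E
}.

Definition rlength (c : rpath) : \bar R := path_length (lo c) (hi c) c.

Definition nonconstant (c : rpath) : Prop :=
  exists2 t, lo c <= t <= hi c & c t <> c (lo c).

(* The arc-length reparametrization at s: the value of c at any parameter t with
   length (c restricted to [lo c, t]) = s; it does not depend on the choice of t. *)
Definition arclength_param (c : rpath) (s : R) : X :=
  c (xget (lo c)
       [set t | lo c <= t <= hi c /\ path_length (lo c) t c = s%:E]).

Definition line_integral (c : rpath) (g : X -> \bar R) : \bar R :=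
  (\int[lebesgue_measure]_(s in `[0%R, fine (rlength c)])
     g (arclength_param c s))%E.

Definition quasiconvex : Prop :=
  exists2 Q : R, 1 <= Q &
    forall x y : X, exists c : rpath,
      [/\ c (lo c) = x, c (hi c) = y & (rlength c <= (Q * mdist x y)%:E)%E].

Definition nonneg_borel (g : X -> \bar R) : Prop :=
  borel_fun g /\ forall x, (0 <= g x)%E.

Definition modulus1 (mu : {outer_measure set X -> \bar R})
    (G : set rpath) : \bar R :=
  ereal_inf [set ointegral mu [set: X] rho
            | rho in [set rho | nonneg_borel rho /\
                forall c, G c -> (1 <= line_integral c rho)%E]].

(* In \bar R, +oo - +oo = -oo, so the left-hand side is +oo as soon as u is
   infinite at an endpoint, which is the usual convention. *)
Definition ug_inequality (u g : X -> \bar R) (c : rpath) : Prop :=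
  (`| u (c (lo c)) - u (c (hi c)) | <= line_integral c g)%E.

(* Constant paths are left out: for them the inequality is void where u is finite,
   and would otherwise forbid u to take the values +oo and -oo. *)
Definition upper_gradient (u g : X -> \bar R) : Prop :=
  nonneg_borel g /\ forall c, nonconstant c -> ug_inequality u g c.

Definition weak_upper_gradient (mu : {outer_measure set X -> \bar R})
    (u g : X -> \bar R) : Prop :=
  nonneg_borel g /\
  exists2 G : set rpath, modulus1 mu G = 0%E &
    forall c, nonconstant c -> ~ G c -> ug_inequality u g c.

Definition loc_integrable (mu : {outer_measure set X -> \bar R})
    (g : X -> \bar R) : Prop :=
  forall x : X, exists2 r, 0 < r & ointegrable mu (ball x r) g.

(* Minimality (almost everywhere) has to be understood among the locally
   integrable 1-weak upper gradients: among all of them a least one need not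
   exist, even for smooth functions on the line.  If X is separable and u has an
   integrable 1-weak upper gradient, the same g are obtained with "integrable" in
   place of "locally integrable". *)
Definition minimal_weak_upper_gradient
    (mu : {outer_measure set X -> \bar R}) (u g : X -> \bar R) : Prop :=
  [/\ weak_upper_gradient mu u g, loc_integrable mu g &
      forall h, weak_upper_gradient mu u h -> loc_integrable mu h ->
        {ae (mu : set (caratheodory_type mu) -> \bar R),
          forall x, (g x <= h x)%E}].

Definition newton_sobolev11 (mu : {outer_measure set X -> \bar R})
    (u : X -> \bar R) : Prop :=
  ointegrable mu [set: X] u /\
  exists2 g, upper_gradient u g & ointegrable mu [set: X] g.

Definition bounded_support (u : X -> \bar R) : Prop :=
  exists (x : X) (r : R), closure [set y | u y != 0%E] `<=` ball x r.

Definition local_weak_poincare11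
    (mu : {outer_measure set X -> \bar R}) : Prop :=
  exists C RP tau : R,
    [/\ 0 < C, 0 < RP, 1 <= tau &
        forall (x : X) (r : R), 0 < r <= RP ->
          (0 < mu (ball x (tau * r)) < +oo)%E /\
          forall (u : X -> R) (g : X -> \bar R),
            ointegrable mu (ball x (tau * r)) (EFin \o u) ->
            minimal_weak_upper_gradient mu (EFin \o u) g ->
            let uB := fine (average mu (ball x r) (EFin \o u)) in
            (average mu (ball x r) (fun y => `|u y - uB|%:E)
             <= (C * r)%:E * average mu (ball x (tau * r)) g)%E].

Definition sobolev11 (mu : {outer_measure set X -> \bar R}) : Prop :=
  exists2 C : R, 0 < C &
    forall u g : X -> \bar R,
      newton_sobolev11 mu u -> bounded_support u ->
      minimal_weak_upper_gradient mu u g ->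
      (ointegral mu [set: X] (fun x => `|u x|)
       <= C%:E * ointegral mu [set: X] g)%E.

End metric_measure_space.
Arguments rpath {R} X.
Arguments quasiconvex {R} X.

Section gromov_hyperbolic.
Context {R : realType} {X : pmetricType R}.

Definition gprod (o x y : X) : R := (mdist x o + mdist y o - mdist x y) / 2.

Definition gromov_hyperbolic : Prop :=
  exists2 delta : R, 0 <= delta &
    forall x y z o : X,
      Num.min (gprod o x y) (gprod o y z) - delta <= gprod o x z.

Definition gromov_seq (o : X) (x : nat -> X) : Prop :=
  (fun ij : nat * nat => gprod o (x ij.1) (x ij.2)) @ filter_prod \oo \oo
    --> +oo.

Definition gromov_equiv (o : X) (x y : nat -> X) : Prop :=
  (fun i => gprod o (x i) (y i)) @ \oo --> +oo.

Record gboundary (o : X) := GBoundary {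
  gclass : set (nat -> X);
  _ : exists2 x, gromov_seq o x &
        gclass = [set y | gromov_seq o y /\ gromov_equiv o x y]
}.

Definition gprod_bb (o : X) (xi eta : gboundary o) : \bar R :=
  ereal_inf [set l | exists x y, [/\ gclass xi x, gclass eta y &
    l = limn_einf (fun i => (gprod o (x i) (y i))%:E)]].

Definition gprod_pb (o x : X) (xi : gboundary o) : \bar R :=
  ereal_inf [set l | exists2 y, gclass xi y &
    l = limn_einf (fun i => (gprod o x (y i))%:E)].

Definition visual : Prop :=
  exists (o : X) (D : R), 0 < D /\
    forall x : X, exists xi : gboundary o,
      ((mdist o x)%:E <= gprod_pb x xi + D%:E)%E.

End gromov_hyperbolic.
Arguments gromov_hyperbolic {R} X.
Arguments visual {R} X.

Section gromov_boundary_topology.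
Context {R : realType} {X : pmetricType R} (o : X).

HB.instance Definition _ := gen_eqMixin (gboundary o).
HB.instance Definition _ := gen_choiceMixin (gboundary o).

Definition gopen (U : set (gboundary o)) : Prop :=
  forall xi, U xi -> exists2 r : R, 0 < r &
    [set eta | (r%:E < gprod_bb xi eta)%E] `<=` U.

Let gopenT : gopen setT.
Proof. by move=> xi _; exists 1. Qed.

Let gopenI : setI_closed gopen.
Proof.
move=> U V oU oV xi [/oU[r r0 rU] /oV[s s0 sV]].
exists (Num.max r s); first by rewrite lt_max r0.
by move=> eta /= h; split; [apply: rU|apply: sV];
  apply: le_lt_trans h; rewrite lee_fin le_max lexx ?orbT.
Qed.

Let gopen_bigU (I : Type) (F : I -> set (gboundary o)) :
  (forall i, gopen (F i)) -> gopen (\bigcup_i F i).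
Proof.
move=> oF xi [i _ /oF[r r0 rF]]; exists r => // eta /rF Feta.
by exists i.
Qed.

HB.instance Definition _ :=
  isOpenTopological.Build (gboundary o) gopenT gopenI gopen_bigU.

End gromov_boundary_topology.

(* Main.v *)
Require Import Defs.
From mathcomp Require Import all_boot all_order all_algebra.
From mathcomp Require Import all_classical all_reals all_analysis.
From mathcomp Require Import measurable_realfun.
From mathcomp Require Import lra.

(* A quasiconvex Gromov hyperbolic space is roughly geodesic, so X looks like a
   cone over its boundary.  Connectedness makes the boundary uniformly perfect:
   above every point x of X, at relative height h, there are as many well
   separated descendants as we like once h is large, whereas the ancestors of a
   given point at relative height -h stay in a ball of radius independent of h.
   On a net this yields a relation of bounded range in which every point has more
   children than parents.  Summing |a x| - |a y| over all pairs of a parent x and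
   a child y bounds the l^1 norm of a finitely supported function a on the net by
   that of its increments along the relation.  For a = averages of u over balls of
   radius R_P, the Poincare inequality along chains of balls bounds the increments
   by integrals of the upper gradient, and also bounds the distance from u to its
   averages. *)

Set Implicit Arguments.
Unset Strict Implicit.
Unset Printing Implicit Defensive.
Import Order.TTheory GRing.Theory Num.Theory.
Import numFieldNormedType.Exports.

Local Open Scope classical_set_scope.
Local Open Scope ring_scope.

(** * Rough geodesics *)

Ltac minmax_free a :=
  lazymatch a with
  | context [@Order.max] => fail
  | context [@Order.min] => fail
  | _ => idtac
  end.

(** Innermost occurrences are split first, so that every comparison produced is free of min and
    max. *)
Ltac split_minmax :=
  repeat match goal with
  | |- context [@Order.max _ _ ?a ?b] =>
      minmax_free a; minmax_free b; case: (leP a b) => ?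
  | |- context [@Order.min _ _ ?a ?b] =>
      minmax_free a; minmax_free b; case: (leP a b) => ?
  end.

Section chains.
Context {R : realType} {X : pmetricType R}.
Implicit Types (x y p q : X) (c : R -> X).

Lemma mdist_lip (x p q : X) : `|mdist x p - mdist x q| <= mdist p q.
Proof.
have h1 := metric_triangle x p q; have h2 := metric_triangle x q p.
rewrite (metric_sym q p) in h2.
by rewrite ler_norml; apply/andP; split; lra.
Qed.

Lemma within_continuous_mdist (A : set R) c (x : X) :
  {within A, continuous c} ->
  {within A, continuous (fun t => mdist x (c t))}.
Proof.
move=> cc t; apply/cvgrPdist_le => e e0.
have := cc t => /cvg_ballP /(_ _ e0).
apply: filterS => s; rewrite ballEmdist /= => h.
exact: le_trans (mdist_lip _ _ _) (ltW h).
Qed.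

(** The chain is constant past [n], so that its number of steps can be prescribed even when the path
    is short. *)
Lemma path_chain (e : R) c (n : nat) (a b : R) : 0 < e -> a <= b ->
  {within `[a, b], continuous c} ->
  (path_length a b c <= (n%:R * e)%:E)%E ->
  exists z : nat -> X, [/\ z 0%N = c a, forall i, (n < i)%N -> z i = c b &
    forall i, mdist (z i) (z i.+1) <= e].
Proof.
move=> e0; elim: n a => [|n IH] a ab cc len;
  have [le_e|gt_e] := leP (mdist (c a) (c b)) e.
- exists (fun i => if i is 0%N then c a else c b); split => //; first by case.
  by case => [|i] //=; rewrite mdistxx ltW.
- have ab' : a < b.
    rewrite lt_neqAle ab andbT; apply: contraTneq gt_e => ->.
    by rewrite mdistxx -leNgt ltW.
  have : ((mdist (c a) (c b))%:E <= path_length a b c)%E.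
    apply: ereal_sup_ubound; exists [:: b]; first exact: itv_partition1.
    by rewrite /= big_nat1.
  move=> /le_trans /(_ len); rewrite lee_fin mul0r => h; lra.
- exists (fun i => if i is 0%N then c a else c b); split => //; first by case.
  by case => [|i] //=; rewrite mdistxx ltW.
- (* Any [t] with [c t] at distance [e] from [c a] will do: what remains of the
     path is shorter by [e]. *)
  have [|t tab ht] := @IVT R (fun t => mdist (c a) (c t)) a b e ab
      (within_continuous_mdist cc).
    rewrite /Order.min /Order.max mdistxx (lt_trans e0 gt_e).
    by rewrite (ltW e0) (ltW gt_e).
  rewrite in_itv/= in tab; case/andP: tab => ta tb.
  have at' : a < t.
    rewrite lt_neqAle ta andbT; apply/eqP => E.
    by move: ht e0; rewrite E mdistxx => <-; rewrite ltxx.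
  have [||z [z0 zb zs]] := IH t tb.
  + apply: continuous_subspaceW cc => s /=; rewrite !in_itv/= => /andP[h ->].
    by rewrite (le_trans ta h).
  + apply: ge_ereal_sup => _ [s [s1 s2] <-].
    have : ((\sum_(0 <= i < size (t :: s))
       mdist (c (nth b (a :: t :: s) i)) (c (nth b (a :: t :: s) i.+1)))%:E
        <= path_length a b c)%E.
      apply: ereal_sup_ubound; exists (t :: s) => //.
      by split => //=; rewrite at' s1.
    move=> /le_trans /(_ len); rewrite !lee_fin big_nat_recl //= ht -natr1.
    rewrite mulrDl mul1r; lra.
  + exists (fun i => if i is j.+1 then z j else c a); split => //.
      by case=> // i; rewrite ltnS; apply: zb.
    by case => [|i] //; rewrite z0 ht.
Qed.

Lemma quasiconvex_chain : quasiconvex X -> exists2 Q : R, 1 <= Q &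
  forall x y (e : R) (n : nat), 0 < e -> Q * mdist x y <= n%:R * e ->
  exists z : nat -> X, [/\ z 0%N = x, forall i, (n < i)%N -> z i = y &
    forall i, mdist (z i) (z i.+1) <= e].
Proof.
case=> Q Q1 qc; exists Q => // x y e n e0 le_n.
have [c0 [h1 h2 h3]] := qc x y.
case: c0 h1 h2 h3 => a b c ab cc fin /= cx cy len.
have len' : (path_length a b c <= (n%:R * e)%:E)%E.
  by apply: (le_trans len); rewrite lee_fin.
by have [z [z0 zn zs]] := path_chain e0 ab cc len'; exists z; rewrite -cx -cy.
Qed.

(** The Gromov product with [f] in the role of the distance to the base point. *)
Definition based_prod (f : X -> R) p q := (f p + f q - mdist p q) / 2.

Definition hyperbolic_from (delta : R) (f : X -> R) :=
  forall p q r, Num.min (based_prod f p q) (based_prod f q r) - delta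
                <= based_prod f p r.

(** By bisection: each of the [k] halvings of the chain costs one [delta]. *)
Lemma hyperbolic_chain (delta m : R) f k (z : nat -> X) :
  hyperbolic_from delta f ->
  (forall i, (i < 2 ^ k)%N -> m <= based_prod f (z i) (z i.+1)) ->
  m - k%:R * delta <= based_prod f (z 0%N) (z (2 ^ k)%N).
Proof.
move=> hyp; elim: k z => [|k IH] z hz.
  by rewrite mul0r subr0 expn0; exact: hz.
have h1 := IH z (fun i hi =>
  hz i (leq_trans hi (@leq_pexp2l 2 _ _ isT (leqnSn k)))).
have h2 : m - k%:R * delta <=
    based_prod f (z (2 ^ k)%N) (z (2 ^ k.+1)%N).
  have := IH (fun i => z (2 ^ k + i)%N); rewrite addn0 addnn -mul2n -expnS.
  apply => i hi /=; rewrite addnS; apply: hz.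
  by rewrite expnS mul2n -addnn ltn_add2l.
apply: le_trans (hyp _ (z (2 ^ k)%N) _).
by rewrite -natr1 mulrDl mul1r opprD addrA lerD2r le_min h1.
Qed.

End chains.

Section rough_geodesics.
Context {R : realType} {X : pmetricType R}.
Variable delta : R.
Hypothesis hyp : forall x y z o : X,
  Num.min (gprod o x y) (gprod o y z) - delta <= gprod o x z.

Lemma four_point (x y z o : X) :
  mdist x z + mdist o y <=
  Num.max (mdist x y + mdist z o) (mdist x o + mdist y z) + 2 * delta.
Proof.
have := hyp x y z o; rewrite /gprod (metric_sym o y) (metric_sym z o).
rewrite (metric_sym o z) (metric_sym y o); split_minmax; lra.
Qed.

(* In a tree, [virtual x y t p] is the distance from [p] to the point of the
   segment [x, y] at distance [t] from [x].  In general it behaves like the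
   distance to a point of a geodesic that need not exist in the space. *)
Definition virtual (x y : X) (t : R) (p : X) : R :=
  Num.max (mdist x p - t) (mdist y p - (mdist x y - t)).

(** In four-point form, the smaller side contains [virtual] only at [q], the larger side only at [p]
    and [r]. The inequality holds for shifted distances and so passes to the maximum of two of
    them. *)
Lemma virtual_hyperbolic x y t : hyperbolic_from delta (virtual x y t).
Proof.
move=> p q r; rewrite /based_prod.
have hx := four_point p q r x; have hy := four_point p q r y.
rewrite (metric_sym p x) (metric_sym r x) in hx hy.
rewrite (metric_sym p y) (metric_sym r y) in hx hy.
have lb z : mdist x z - t <= virtual x y t z /\
    mdist y z - (mdist x y - t) <= virtual x y t z.
  by rewrite /virtual !le_max !lexx orbT.
have [p1 p2] := lb p; have [r1 r2] := lb r.
have [->|->] : virtual x y t q = mdist x q - t \/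
    virtual x y t q = mdist y q - (mdist x y - t).
  by rewrite /virtual; case: leP => _; [right|left].
- by move: hx; split_minmax; lra.
- by move: hy; split_minmax; lra.
Qed.

(** The two shifts in [virtual] add up to [mdist x y], so this is the four-point inequality for [p],
    [x], [q], [y]. It replaces the triangle inequality through the virtual point. *)
Lemma virtual_ge x y t p q :
  mdist p q <= virtual x y t p + virtual x y t q + 2 * delta.
Proof.
have h := four_point p x q y.
rewrite (metric_sym q y) (metric_sym p y) (metric_sym p x) (metric_sym y x) in h.
rewrite /virtual; move: h; split_minmax; lra.
Qed.

Lemma virtual_lip x y t p q : virtual x y t p <= virtual x y t q + mdist p q.
Proof.
have h1 := metric_triangle x q p; have h2 := metric_triangle y q p.
rewrite (metric_sym q p) in h1 h2.
rewrite /virtual; split_minmax; lra.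
Qed.

Lemma virtual_left x y t : 0 <= t -> virtual x y t x = t.
Proof.
move=> t0; rewrite /virtual mdistxx (metric_sym y x).
by split_minmax; lra.
Qed.

Lemma virtual_right x y t : t <= mdist x y -> virtual x y t y = mdist x y - t.
Proof.
by move=> t0; rewrite /virtual mdistxx; split_minmax; lra.
Qed.

(* The points at positions [t - M] and [t + M] of a path following the virtual
   segment up to [E] are joined by a path of length [O(E)]; a chain of [n] points
   passes within [delta * log n + O(1)] of the virtual point. *)
Lemma rough_geodesic_step : 1 <= delta -> quasiconvex X ->
  exists2 C : R, 0 <= C & forall (x y : X) (E : R),
  0 <= E ->
  (forall t : R, 0 <= t <= mdist x y -> exists p, virtual x y t p <= E) ->
  (forall t : R, 0 <= t <= mdist x y -> exists p, virtual x y t p <= E / 2 + C).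
Proof.
move=> delta1 qc; have [Q Q1 chain] := quasiconvex_chain qc.
have d0 : 0 <= delta by lra.
have d14 : (0 : R) <= 14 * delta + 4 by lra.
have k00 : 0 <= Q * (14 * delta + 4) by apply: mulr_ge0; lra.
pose k0 := Num.truncn (Q * (14 * delta + 4)).
have hk0 : Q * (14 * delta + 4) <= 2 ^+ k0.+1.
  have /andP[_ /ltW h] : k0%:R <= Q * (14 * delta + 4) < k0.+1%:R.
    by apply: truncn_itv.
  apply: le_trans h _; rewrite -natrX ler_nat; apply: ltnW; exact: ltn_expl.
exists (k0.+1%:R * delta + 2 * delta + 2).
  by have := mulr_ge0 (ler0n R k0.+1) d0; lra.
move=> x y E E0 hE t /andP[t0 tL].
set f := virtual x y t.
(* With this [M], a point within [E] of position [t - M] has product at least [2 * delta + 1] with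
   [x]; likewise for [t + M] and [y]. *)
have [M ME] : exists M, M = E + 2 * delta + 1 by exists (E + 2 * delta + 1).
have fx : f x = t by exact: virtual_left.
have fy : f y = mdist x y - t by exact: virtual_right.
have [x' fx' px'] : exists2 x', f x' <= M + E &
    x' = x \/ 2 * delta + 1 <= based_prod f x x'.
  have [tM|tM] := ltP t M.
    by exists x; [rewrite fx; lra|left].
  have [|x' hx'] := hE (t - M); first by apply/andP; split; lra.
  have tri := metric_triangle x x' y; rewrite (metric_sym x' y) in tri.
  exists x'; last (right; rewrite /based_prod fx); move: hx' tri;
    rewrite /f /virtual; split_minmax; lra.
have [y' fy' py'] : exists2 y', f y' <= M + E &
    y' = y \/ 2 * delta + 1 <= based_prod f y' y.
  have [tM|tM] := ltP (mdist x y - t) M.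
    by exists y; [rewrite fy; lra|left].
  have [|y' hy'] := hE (t + M); first by apply/andP; split; lra.
  have tri := metric_triangle x y' y; rewrite (metric_sym y' y) in tri.
  exists y'; last (right; rewrite /based_prod fy (metric_sym y' y)); move: hy' tri;
    rewrite /f /virtual; split_minmax; lra.
have hf : hyperbolic_from delta f := @virtual_hyperbolic x y t.
(* The virtual point lies between [x] and [y], so their product is zero; hyperbolicity passes this
   on to [x'] and [y'] up to [2 * delta]. *)
have xy0 : based_prod f x y = 0 by rewrite /based_prod fx fy; lra.
have x'y : based_prod f x' y <= delta.
  case: px' => [->|px']; first by rewrite xy0; lra.
  by have := hf x x' y; rewrite xy0; split_minmax; lra.
have x'y' : based_prod f x' y' <= 2 * delta.
  case: py' => [->|py']; first by lra.
  by have := hf x' y' y; split_minmax; lra.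
have d' : mdist x' y' <= 4 * E + 6 * delta + 2.
  have := virtual_ge x y t x' y'; rewrite -/f; lra.
(* Now [m * delta <= E / 2], which halves the error, while [2 ^ m] still dominates
   [E / (2 * delta)]. The fixed [k0] absorbs the remaining constants of the path length. *)
pose m := Num.truncn (E / (2 * delta)).
have /andP[m1 m2] : m%:R <= E / (2 * delta) < m.+1%:R.
  by apply: truncn_itv; apply: divr_ge0; lra.
rewrite ler_pdivlMr in m1; last by lra.
rewrite ltr_pdivrMr in m2; last by lra.
have hm : m.+1%:R <= 2 ^+ m :> R by rewrite -natrX ler_nat; exact: ltn_expl.
have hm1 : 1 <= 2 ^+ m :> R by apply: le_trans hm; rewrite ler1n.
pose k := (m + k0.+1)%N.
have hk : Q * mdist x' y' <= (2 ^ k).-1%:R * 1.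
  have -> : (2 ^ k).-1%:R = 2 ^+ k - 1 :> R.
    by rewrite -natrX -{2}(@prednK (2 ^ k)) ?expn_gt0// -natr1 addrK.
  rewrite mulr1 /k exprD.
  apply: (@le_trans _ _ (2 ^+ m * (Q * (14 * delta + 4)) - 1)); last first.
    by rewrite lerD2r ler_wpM2l//; lra.
  have hE' : E <= 2 * delta * 2 ^+ m by nra.
  apply: (@le_trans _ _ (Q * (4 * E + 6 * delta + 2))).
    by rewrite ler_wpM2l//; lra.
  have hQ : 1 <= Q * 2 ^+ m by nra.
  have hd : delta <= delta * 2 ^+ m by nra.
  have : Q * (4 * E + 6 * delta + 2) <= Q * ((14 * delta + 2) * 2 ^+ m).
    by rewrite ler_wpM2l; lra.
  nra.
have [z [z0 zy zs]] := chain x' y' 1 _ ltr01 hk.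
have zk : z (2 ^ k)%N = y' by apply: zy; rewrite prednK // expn_gt0.
(* If all chain points were farther away, consecutive products would be at least
   [k * delta + 2 * delta + 1], and [k] bisections would leave more than [2 * delta] for [x'] and
   [y']. *)
have [[i hi] | H] := pselect (exists i,
    f (z i) <= k%:R * delta + 2 * delta + 2).
  exists (z i); apply: le_trans hi _; rewrite /k natrD; lra.
have hh : 2 * delta + 1 <= based_prod f x' y'.
  have := @hyperbolic_chain _ _ delta (2 * delta + 1 + k%:R * delta) f k z hf.
  rewrite z0 zk addrK; apply => i _.
  have fi : k%:R * delta + 2 * delta + 2 < f (z i).
    by rewrite ltNge; apply/negP => h; apply: H; exists i.
  have := virtual_lip x y t (z i) (z i.+1); have := zs i.
  rewrite -/f /based_prod; lra.
lra.
Qed.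

(** The step is iterated from [E = mdist x y], where [x] itself serves. The errors tend
    geometrically to [2 * C], the fixed point of [E / 2 + C], whatever the distance was. *)
Lemma rough_geodesic : 1 <= delta -> quasiconvex X ->
  exists2 C : R, 0 <= C & forall (x y : X) (t : R),
  0 <= t <= mdist x y -> exists p, virtual x y t p <= C.
Proof.
move=> delta1 qc; have [C C0 step] := rough_geodesic_step delta1 qc.
exists (2 * C + 1) => [|x y]; first lra.
pose L := mdist x y; have L0 : 0 <= L := mdist_ge0 x y.
have main n : forall t : R, 0 <= t <= L ->
    exists p, virtual x y t p <= L / 2 ^+ n + 2 * C.
  elim: n => [|n IH] t ht.
    exists x; have /andP[t0 tL] := ht; rewrite virtual_left //; rewrite expr0; lra.
  have p2 : 0 <= L / 2 ^+ n by apply: divr_ge0 => //; rewrite exprn_ge0.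
  have [|p hp] := step x y _ _ IH t ht; first lra.
  exists p; apply: le_trans hp _; rewrite exprSr invfM.
  set a := _^-1 in p2 *; rewrite !mulrA; lra.
move=> t ht; have [p hp] := main (Num.truncn L).+1 t ht; exists p.
apply: le_trans hp _; rewrite addrC lerD2l ler_pdivrMr ?exprn_gt0// mul1r.
have /andP[_ h] := truncn_itv L0; apply: ltW; apply: lt_le_trans h _.
by rewrite -natrX ler_nat; apply: ltnW; exact: ltn_expl.
Qed.

End rough_geodesics.

(** * Children and parents *)

Lemma eventually_all_lt (P : nat -> nat -> Prop) (m : nat) :
  (forall j, exists N, forall i, (N <= i)%N -> P j i) ->
  exists N, forall j i, (j < m)%N -> (N <= i)%N -> P j i.
Proof.
move=> H; elim: m => [|m [N hN]]; first by exists 0%N.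
have [N' hN'] := H m; exists (maxn N N') => j i; rewrite geq_max ltnS leq_eqVlt.
by move=> /orP[/eqP ->|jm] /andP[? ?]; [exact: hN'|exact: hN].
Qed.

Section children.
Context {R : realType} {X : pmetricType R}.
Implicit Types (x y p : X).

Lemma gprodC (o x y : X) : gprod o x y = gprod o y x.
Proof. by rewrite /gprod (metric_sym x y) [mdist x o + _]addrC. Qed.

Definition gromov_sequence (o : X) (z : nat -> X) :=
  forall r : R, exists N, forall i j, (N <= i)%N -> (N <= j)%N ->
    r <= gprod o (z i) (z j).

(* Far away [z] and [b] approximate two boundary points whose Gromov product is
   [r] up to [C]. *)
Definition branching (o : X) (C r0 : R) :=
  forall z, gromov_sequence o z -> forall r M : R, r0 <= r ->
  exists N, forall i, (N <= i)%N -> exists b : X,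
    [/\ M <= mdist b o, r - C <= gprod o (z i) b & gprod o (z i) b <= r + C].

Definition visual_from (o : X) (D : R) :=
  forall x, exists2 z, gromov_sequence o z &
    exists N, forall i, (N <= i)%N -> mdist x o - D <= gprod o x (z i).

(* The constant [C] depends neither on the number [m] of children nor on their
   height [h]: by [parents_close] the number of parents is then bounded before
   [m] is chosen. *)
Definition far_children (o : X) (C : R) := forall (m : nat) (S : R),
  exists2 h : R, 0 <= h & forall x, exists y : nat -> X,
   (forall j, (j < m)%N -> mdist x (y j) <= h + C /\
      mdist x o + h - C <= mdist (y j) o) /\
   (forall i j, (i < j < m)%N -> S <= mdist (y i) (y j)).

Variable delta : R.
Hypothesis hyp : forall x y z o : X,
  Num.min (gprod o x y) (gprod o y z) - delta <= gprod o x z.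

(** Both [x] and [x'] lie roughly on a geodesic from [o] to [y], at heights differing by at most
    [2 * C]; the height [h] cancels. *)
Lemma parents_close (o x x' y : X) (h C : R) :
  mdist x y <= h + C -> mdist x o + h - C <= mdist y o ->
  mdist x' y <= h + C -> mdist x' o + h - C <= mdist y o ->
  mdist x x' <= 4 * C + 2 * delta.
Proof.
move=> h1 h2 h3 h4.
have := hyp x y x' o; have := metric_triangle x y o.
have := metric_triangle x' y o; have t1 := metric_triangle y x o.
have t2 := metric_triangle y x' o; rewrite (metric_sym y x) in t1.
rewrite (metric_sym y x') in t2.
by rewrite /gprod (metric_sym y x'); split_minmax; lra.
Qed.

Lemma point_at_height (o b : X) (C0 s : R) :
  (forall (x y : X) (t : R), 0 <= t <= mdist x y ->
     exists p, virtual x y t p <= C0) ->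
  0 <= s <= mdist b o ->
  exists p, [/\ s - C0 <= mdist p o, mdist p o <= s + C0 &
    s - C0 <= gprod o b p].
Proof.
move=> rough sb; have [|p] := rough o b s; first by rewrite metric_sym.
rewrite /virtual ge_max => /andP[h1 h2]; exists p.
have := metric_triangle b p o.
rewrite /gprod; rewrite (metric_sym o p) in h1; rewrite (metric_sym o b) in h2.
by split; lra.
Qed.

(** A ray passing near [x] is followed to a far point [a]. Points [b j] leave it at heights spaced
    by [A] and are cut down to a common height, giving [y j]; two of these separate near the lower
    branching height. *)
Lemma branching_children (o : X) (C0 C1 r0 D : R) :
  0 <= delta -> 0 <= C0 -> 0 <= C1 -> 0 <= r0 -> 0 <= D ->
  (forall (x y : X) (t : R), 0 <= t <= mdist x y ->
     exists p, virtual x y t p <= C0) ->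
  branching o C1 r0 -> visual_from o D ->
  far_children o (r0 + 3 * C0 + 2 * D + 2 * C1 + 4 * delta).
Proof.
move=> d0 C00 C10 r00 D0 rough br vis m S.
(* The spacing exceeds the error [2 * C1] of the branching heights by more than [delta]. *)
have [A AE] : exists A, A = 2 * C1 + delta + 1 by exists (2 * C1 + delta + 1).
have A0 : 0 <= A by lra.
have mA0 : 0 <= m%:R * A by rewrite mulr_ge0 ?ler0n.
(* High enough above the last branching height for the children to be [S] apart. *)
have [h hE] : exists h, h = m%:R * A + C1 + 3 * delta + C0 + 1 + `|S|.
  by eexists; reflexivity.
have S0 := normr_ge0 S.
have h0 : 0 <= h by lra.
exists h => // x.
have [z gz [N0 hN0]] := vis x.
have [T TE] : exists T, T = mdist x o + r0 by eexists; reflexivity.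
have x0 := mdist_ge0 x o.
have jA (j : nat) : 0 <= j%:R * A by rewrite mulr_ge0 ?ler0n.
have [j|N hN] := @eventually_all_lt (fun j i => exists b : X,
    [/\ T + h <= mdist b o, T + j%:R * A - C1 <= gprod o (z i) b &
        gprod o (z i) b <= T + j%:R * A + C1]) m.
  by apply: br => //; have := jA j; lra.
pose a := z (maxn N N0).
have xa : mdist x o - D <= gprod o x a by apply: hN0; exact: leq_maxr.
have /choice[b hb] : forall j, exists b, (j < m)%N ->
    [/\ T + h <= mdist b o, T + j%:R * A - C1 <= gprod o a b &
        gprod o a b <= T + j%:R * A + C1].
  move=> j; case: (boolP (j < m)%N) => jm; last by exists o.
  by have [b hb] := hN j _ jm (leq_maxl N N0); exists b.
have /choice[y hy] : forall j, exists y, (j < m)%N ->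
    [/\ T + h - C0 <= mdist y o, mdist y o <= T + h + C0 &
        T + h - C0 <= gprod o (b j) y].
  move=> j; case: (boolP (j < m)%N) => jm; last by exists o.
  have [b1 _ _] := hb j jm.
  have [|p hp] := @point_at_height o (b j) C0 (T + h) rough.
    by apply/andP; split; lra.
  by exists p.
exists y; split=> [j jm|i j /andP[ij jm]].
  have [b1 b2 b3] := hb j jm; have [y1 y2 y3] := hy j jm; have jAj := jA j.
  split; last by lra.
  have : mdist x o - D - C1 - C0 - 2 * delta <= gprod o x (y j).
    by move: (hyp x a (b j) o) (hyp x (b j) (y j) o); split_minmax; lra.
  by rewrite {1}/gprod; lra.
have im : (i < m)%N by exact: ltn_trans jm.
have [b1 b2 b3] := hb i im; have [y1 y2 y3] := hy i im.
have [b1' b2' b3'] := hb j jm; have [y1' y2' y3'] := hy j jm.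
have iA : i%:R * A + A <= j%:R * A.
  by rewrite -{2}[A]mul1r -mulrDl ler_wpM2r// natr1 ler_nat.
have iA' : i%:R * A + A <= m%:R * A.
  by rewrite -{2}[A]mul1r -mulrDl ler_wpM2r// natr1 ler_nat.
(* The minimum in the hyperbolicity inequality cannot be [gprod o a (b j)], which exceeds
   [gprod o a (b i)] by more than [delta]. *)
have bb : gprod o (b j) (b i) <= T + i%:R * A + C1 + delta.
  by move: (hyp a (b j) (b i) o); split_minmax; lra.
have yy : gprod o (y j) (y i) <= T + i%:R * A + C1 + 3 * delta.
  rewrite (gprodC o (b i)) in y3; move: (hyp (b j) (y j) (b i) o).
  by move: (hyp (y j) (y i) (b i) o); split_minmax; lra.
have := ler_norm S; move: yy; rewrite {1}/gprod (metric_sym (y j) (y i)); lra.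
Qed.

End children.

(** * The Gromov boundary *)

Section limit_inferior.
Context {R : realType}.
Implicit Types u : nat -> \bar R.

Lemma limn_einf_sup_einfs u : limn_einf u = ereal_sup (range (einfs u)).
Proof. by rewrite limn_einf_lim; apply/cvg_lim => //; exact: cvg_einfs_sup. Qed.

Lemma lt_limn_einf u (r : \bar R) : (r < limn_einf u)%E ->
  exists N, forall i, (N <= i)%N -> (r < u i)%E.
Proof.
rewrite limn_einf_sup_einfs => /ereal_sup_gt[_ [N _ <-] rN].
exists N => i Ni; apply: lt_le_trans rN _; apply: ereal_inf_lbound.
by exists i.
Qed.

Lemma le_limn_einf u (r : \bar R) N : (forall i, (N <= i)%N -> (r <= u i)%E) ->
  (r <= limn_einf u)%E.
Proof.
move=> h; rewrite limn_einf_sup_einfs.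
apply: (@le_trans _ _ (einfs u N)); last by apply: ereal_sup_ubound; exists N.
by apply: le_ereal_inf_tmp => _ [i Ni <-]; exact: h.
Qed.

End limit_inferior.

Section boundary.
Context {R : realType} {X : pmetricType R}.

Lemma gromov_seqP (o : X) z : gromov_seq o z <-> gromov_sequence o z.
Proof.
split=> [/cvgryPge h r|h].
  have [[A B] /= [[N1 _ h1] [N2 _ h2]] hAB] := h r.
  exists (maxn N1 N2) => i j; rewrite !geq_max => /andP[i1 _] /andP[_ j2].
  by apply: (hAB (i, j)); split; [exact: h1|exact: h2].
apply/cvgryPge => r; have [N hN] := h r.
exists ([set i | (N <= i)%N], [set i | (N <= i)%N]); first by split; exists N.
by move=> [i j] [/= i1 j1]; exact: hN.
Qed.

Lemma gromov_equivP (o : X) y z : gromov_equiv o y z <->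
  forall r : R, exists N, forall i, (N <= i)%N -> r <= gprod o (y i) (z i).
Proof.
split=> [/cvgryPge h r|h]; first by have [N _ hN] := h r; exists N.
by apply/cvgryPge => r; have [N hN] := h r; exists N.
Qed.

Variables (o : X) (delta : R).
Hypothesis hyp : forall x y z o : X,
  Num.min (gprod o x y) (gprod o y z) - delta <= gprod o x z.

Definition eventually_ge (f : nat -> R) (r : R) :=
  exists N, forall i, (N <= i)%N -> r <= f i.

Lemma eventually_gprod_trans (x y z : nat -> X) (r : R) :
  eventually_ge (fun i => gprod o (x i) (y i)) r ->
  eventually_ge (fun i => gprod o (y i) (z i)) r ->
  eventually_ge (fun i => gprod o (x i) (z i)) (r - delta).
Proof.
move=> [N hN] [M hM]; exists (maxn N M) => i; rewrite geq_max => /andP[Ni Mi].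
by have := hyp (x i) (y i) (z i) o; have := hN _ Ni; have := hM _ Mi;
  split_minmax; lra.
Qed.

Lemma gromov_equiv_sym (x y : nat -> X) :
  gromov_equiv o x y -> gromov_equiv o y x.
Proof.
move=> /gromov_equivP h; apply/gromov_equivP => r; have [N hN] := h r.
by exists N => i /hN; rewrite gprodC.
Qed.

Lemma gromov_equiv_trans (x y z : nat -> X) :
  gromov_equiv o x y -> gromov_equiv o y z -> gromov_equiv o x z.
Proof.
move=> /gromov_equivP xy /gromov_equivP yz; apply/gromov_equivP => r.
by have := eventually_gprod_trans (xy (r + delta)) (yz (r + delta)); rewrite addrK.
Qed.

Lemma gromov_equiv_refl (x : nat -> X) : gromov_sequence o x -> gromov_equiv o x x.
Proof.
move=> h; apply/gromov_equivP => r; have [N hN] := h r.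
by exists N => i Ni; exact: hN.
Qed.

Lemma gclass_inhabited (xi : gboundary o) : exists x, gclass xi x.
Proof.
case: xi => A /= [x gx ->]; exists x; split=> //.
by apply: gromov_equiv_refl; exact/gromov_seqP.
Qed.

Lemma gclassE (xi : gboundary o) x : gclass xi x ->
  gclass xi = [set y | gromov_seq o y /\ gromov_equiv o x y].
Proof.
case: xi => A /= [z gz ->] [gx zx]; apply/seteqP; split=> y [gy h]; split=> //.
  exact: gromov_equiv_trans (gromov_equiv_sym zx) h.
exact: gromov_equiv_trans zx h.
Qed.

Lemma gclass_gromov (xi : gboundary o) x : gclass xi x -> gromov_sequence o x.
Proof. by move=> h; move: (h); rewrite (gclassE h) => -[/gromov_seqP]. Qed.

Lemma gclass_equiv (xi : gboundary o) x y : gclass xi x -> gclass xi y ->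
  forall r, eventually_ge (fun i => gprod o (x i) (y i)) r.
Proof. by move=> hx; rewrite (gclassE hx) => -[_ /gromov_equivP]. Qed.

Lemma gboundary_eq (xi eta : gboundary o) : gclass xi = gclass eta -> xi = eta.
Proof.
case: xi => A hA; case: eta => B hB /= E; move: hA; rewrite E => hA.
by congr GBoundary; exact: Prop_irrelevance.
Qed.

Lemma gprod_bb_gt (xi eta : gboundary o) (r : R) x y :
  (r%:E < gprod_bb xi eta)%E -> gclass xi x -> gclass eta y ->
  eventually_ge (fun i => gprod o (x i) (y i)) r.
Proof.
move=> h hx hy.
have [|N hN] := @lt_limn_einf _ (fun i => (gprod o (x i) (y i))%:E) r%:E.
  by apply: lt_le_trans h _; apply: ereal_inf_lbound; exists x, y.
by exists N => i /hN; rewrite lte_fin => /ltW.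
Qed.

(** Changing the representative at either end costs one [delta], since equivalent sequences have
    products tending to infinity. *)
Lemma gprod_bb_ge (xi eta : gboundary o) (r : R) x y :
  gclass xi x -> gclass eta y ->
  eventually_ge (fun i => gprod o (x i) (y i)) r ->
  ((r - 2 * delta)%:E <= gprod_bb xi eta)%E.
Proof.
move=> hx hy xy; apply: le_ereal_inf_tmp => _ [x' [y' [hx' hy' ->]]].
have [||N hN] := @eventually_gprod_trans x' x y' (r - delta).
- exact: gclass_equiv hx' hx _.
- by apply: eventually_gprod_trans xy _; exact: gclass_equiv hy hy' _.
apply: (@le_limn_einf _ _ _ N) => i /hN; rewrite lee_fin; lra.
Qed.

(** The boundary product is only a lower limit, but one large product past [N] makes all products
    past [N] large, up to [2 * delta]. Hence the bound holds at every late index. *)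
Lemma gprod_bb_le (xi eta : gboundary o) (r : R) x y : 0 <= delta ->
  gclass xi x -> gclass eta y -> (gprod_bb xi eta <= r%:E)%E ->
  exists N, forall i, (N <= i)%N -> gprod o (x i) (y i) <= r + 4 * delta + 1.
Proof.
move=> d0 hx hy bb.
have [N1 hN1] := gclass_gromov hx (r + 4 * delta + 2).
have [N2 hN2] := gclass_gromov hy (r + 4 * delta + 2).
exists (maxn N1 N2) => j; rewrite geq_max => /andP[j1 j2].
rewrite leNgt; apply/negP => gt_j.
have : eventually_ge (fun i => gprod o (x i) (y i)) (r + 2 * delta + 1).
  exists (maxn N1 N2) => i; rewrite geq_max => /andP[i1 i2].
  have := hyp (x i) (x j) (y i) o; have := hyp (x j) (y j) (y i) o.
  have := hN1 _ _ i1 j1; have := hN2 _ _ j2 i2.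
  by split_minmax; lra.
move=> /(gprod_bb_ge hx hy) /le_trans /(_ bb); rewrite lee_fin; lra.
Qed.

(** One [delta] pays for the composition, two for the change of representatives. *)
Lemma gprod_bb_trans (xi eta zeta : gboundary o) (r : R) :
  (r%:E < gprod_bb xi eta)%E -> (r%:E < gprod_bb eta zeta)%E ->
  ((r - 3 * delta)%:E <= gprod_bb xi zeta)%E.
Proof.
move=> h1 h2; have [x hx] := gclass_inhabited xi.
have [y hy] := gclass_inhabited eta; have [z hz] := gclass_inhabited zeta.
have := gprod_bb_ge hx hz (eventually_gprod_trans (gprod_bb_gt h1 hx hy)
  (gprod_bb_gt h2 hy hz)).
by congr (_ <= _)%E; congr EFin; lra.
Qed.

Lemma gprod_bbC (xi eta : gboundary o) : gprod_bb xi eta = gprod_bb eta xi.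
Proof.
by congr ereal_inf; apply/seteqP; split=> _ [x [y [hx hy ->]]]; exists y, x;
  split=> //; congr limn_einf; apply/funext => i; rewrite gprodC.
Qed.

Lemma gprod_bb_self (xi : gboundary o) (r : R) : (r%:E < gprod_bb xi xi)%E.
Proof.
have [x hx] := gclass_inhabited xi.
have := gprod_bb_ge hx hx (gclass_equiv hx hx (r + 1 + 2 * delta)).
by apply: lt_le_trans; rewrite lte_fin; lra.
Qed.

Lemma gprod_bb_fin (xi eta : gboundary o) : xi <> eta ->
  exists r : R, (gprod_bb xi eta <= r%:E)%E.
Proof.
move=> ne; apply: contrapT => H; apply: ne; apply: gboundary_eq.
have [x hx] := gclass_inhabited xi; have [y hy] := gclass_inhabited eta.
have xy : gromov_equiv o x y.
  apply/gromov_equivP => r; apply: (@gprod_bb_gt xi eta) => //.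
  by rewrite ltNge; apply/negP => h; apply: H; exists r.
rewrite (gclassE hx) (gclassE hy); apply/seteqP; split=> z [gz h]; split=> //.
  exact: gromov_equiv_trans (gromov_equiv_sym xy) h.
exact: gromov_equiv_trans xy h.
Qed.

(* If no boundary point had Gromov product with [xi] in the window
   (r - 3 delta - 1, r], then {eta | r < (xi|eta)} would be open and closed. *)
Lemma boundary_annulus (xi : gboundary o) (r : R) :
  connected [set: gboundary o] -> 0 < r ->
  (exists eta, (gprod_bb xi eta <= r%:E)%E) ->
  exists2 eta, ((r - 3 * delta - 1)%:E < gprod_bb xi eta)%E &
    (gprod_bb xi eta <= r%:E)%E.
Proof.
move=> conn r0 [eta0 far]; apply: contrapT => H.
have gap eta : ((r - 3 * delta - 1)%:E < gprod_bb xi eta)%E ->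
    (r%:E < gprod_bb xi eta)%E.
  by move=> h; rewrite ltNge; apply/negP => h'; apply: H; exists eta.
(* The loss [3 * delta] of [gprod_bb_trans] ends in the empty window and is regained. *)
have gap' eta : ((r - 3 * delta)%:E <= gprod_bb xi eta)%E ->
    (r%:E < gprod_bb xi eta)%E.
  by move=> h; apply: gap; apply: lt_le_trans h; rewrite lte_fin; lra.
pose B := [set eta | (r%:E < gprod_bb xi eta)%E].
suff : B = [set: gboundary o].
  by move=> /seteqP[_ /(_ eta0 I)]; rewrite /B /= ltNge far.
apply: conn.
- by exists xi; exact: gprod_bb_self.
- exists B; last by rewrite setTI.
  move=> eta Beta; exists r => // zeta /= h.
  exact: gap' (gprod_bb_trans Beta h).
- exists B; last by rewrite setTI.
  rewrite -openC; change (gopen (~` B)) => eta nBeta.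
  exists r => // zeta /= h Bzeta; apply: nBeta.
  by apply: gap' (gprod_bb_trans Bzeta _); rewrite gprod_bbC.
Qed.

(** The sequence [z] defines a boundary point [xi]; a representative of a point [eta] in an annulus
    around [xi] supplies the points [b]. *)
Lemma connected_boundary_branching : 0 <= delta ->
  connected [set: gboundary o] -> (exists xi eta : gboundary o, xi <> eta) ->
  exists C r0 : R, [/\ 0 <= C, 0 <= r0 & branching o C r0].
Proof.
move=> d0 conn [xi1 [xi2 /gprod_bb_fin[s hs]]].
(* The entry [1] keeps [r] positive for [boundary_annulus]; the other one ensures that [xi1] or
   [xi2] has product at most [r] with [xi]. *)
exists (4 * delta + 1), (Num.max 1 (s + 3 * delta + 1)).
have r0 : 0 < Num.max 1 (s + 3 * delta + 1) by rewrite lt_max ltr01.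
split; [lra|exact: ltW|move=> z gz r M rr].
have gz' : gromov_seq o z by exact/gromov_seqP.
pose xi : gboundary o := @GBoundary _ _ o
  [set y | gromov_seq o y /\ gromov_equiv o z y] (ex_intro2 _ _ z gz' erefl).
have zxi : gclass xi z by split => //; exact: gromov_equiv_refl.
have far : exists eta, (gprod_bb xi eta <= r%:E)%E.
  have sr : s + 3 * delta + 1 <= r by move: rr; rewrite ge_max => /andP[].
  have [h1|h1] := leP (gprod_bb xi xi1) r%:E; first by exists xi1.
  have [h2|h2] := leP (gprod_bb xi xi2) r%:E; first by exists xi2.
  rewrite gprod_bbC in h1; have := gprod_bb_trans h1 h2.
  by move=> /le_trans /(_ hs); rewrite lee_fin; lra.
have [eta h1 h2] := boundary_annulus conn (lt_le_trans r0 rr) far.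
have [y hy] := gclass_inhabited eta.
have [N1 hN1] := gprod_bb_gt h1 zxi hy.
have [N2 hN2] := gprod_bb_le d0 zxi hy h2.
have [N3 hN3] := gclass_gromov hy M.
exists (maxn N1 (maxn N2 N3)) => i; rewrite !geq_max => /and3P[i1 i2 i3].
exists (y i); split; first by have := hN3 _ _ i3 i3; rewrite /gprod mdistxx; lra.
  by have := hN1 _ i1; lra.
by have := hN2 _ i2; lra.
Qed.

End boundary.

Section geometry.
Context {R : realType} {X : pmetricType R}.

Lemma gprod_base (o o' x y : X) : gprod o' x y <= gprod o x y + mdist o o'.
Proof.
have := metric_triangle x o o'; have := metric_triangle y o o'.
rewrite /gprod; lra.
Qed.

(** The base point supplied by [visual] may differ from [o]: the change costs [2 * mdist o o'], and
    [1] makes the inequality strict below the lower limit. *)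
Lemma visual_fromP (o : X) : visual X -> exists2 D : R, 0 <= D & visual_from o D.
Proof.
case=> o' [D [D0 vis]]; have oo := mdist_ge0 o o'.
exists (D + 1 + 2 * mdist o o'); first lra.
move=> x; have [[A [z gz AE]] /= h] := vis x.
exists z.
  move=> r; have [N hN] := (gromov_seqP o' z).1 gz (r + mdist o o').
  exists N => i j Ni Nj; have := hN i j Ni Nj.
  by have := gprod_base o o' (z i) (z j); lra.
have [|N hN] := @lt_limn_einf _ (fun i => (gprod o' x (z i))%:E) (mdist o' x - D - 1)%:E.
  apply: (@lt_le_trans _ _ (mdist o' x - D)%:E); first by rewrite lte_fin; lra.
  rewrite EFinB leeBlDr//; apply: le_trans h _; rewrite leeD2r//.
  apply: ereal_inf_lbound; exists z => //=; rewrite AE; split=> //.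
  exact/gromov_equiv_refl/gromov_seqP.
exists N => i /hN; rewrite lte_fin; have := gprod_base o o' x (z i).
have := metric_triangle x o' o; rewrite (metric_sym x o') (metric_sym o' o); lra.
Qed.

Lemma hyperbolic_children (o : X) : gromov_hyperbolic X -> quasiconvex X ->
  visual X -> connected [set: gboundary o] ->
  (exists xi eta : gboundary o, xi <> eta) ->
  exists delta C : R, [/\ 0 <= delta, 0 <= C, far_children o C &
    forall x x' y h C', mdist x y <= h + C' -> mdist x o + h - C' <= mdist y o ->
      mdist x' y <= h + C' -> mdist x' o + h - C' <= mdist y o ->
      mdist x x' <= 4 * C' + 2 * delta].
Proof.
move=> [delta0 d0 hyp0] qc vis conn two.
have [delta d1 hyp] : exists2 delta : R, 1 <= delta & forall x y z o : X,
    Num.min (gprod o x y) (gprod o y z) - delta <= gprod o x z.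
  exists (delta0 + 1); first lra.
  by move=> x y z p; have := hyp0 x y z p; split_minmax; lra.
have d0' : 0 <= delta by lra.
have [C0 C00 rough] := rough_geodesic hyp d1 qc.
have [C1 [r0 [C10 r00 br]]] := connected_boundary_branching hyp d0' conn two.
have [D D0 visD] := visual_fromP o vis.
exists delta; eexists; split; [exact: d0'| |
  exact: (branching_children hyp d0' C00 C10 r00 D0 rough br visD)|].
  lra.
by move=> x x' y h C'; apply: parents_close.
Qed.

End geometry.

(** * Counting and integration *)

Lemma uniq_count_le1 (T : eqType) (p : pred T) (s : seq T) : uniq s ->
  (forall x y, x \in s -> y \in s -> p x -> p y -> x = y) -> (count p s <= 1)%N.
Proof.
elim: s => //= a s IH /andP[as_ us] h.
have IHs : (count p s <= 1)%N.
  by apply: IH => // x y xs ys; apply: h; rewrite inE ?xs ?ys orbT.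
case: (boolP (p a)) => pa //=; rewrite add1n ltnS leqNgt -has_count.
apply/hasPn => x xs; apply/negP => px.
have xa := h x a; rewrite !inE xs eqxx orbT in xa.
by move: as_; rewrite -(xa isT isT px pa) xs.
Qed.

(* Double counting over the pairs (x, y) with [r x y]: every such pair contributes
   w x - w y, and each x is counted at least P + 1 times on the left and at most
   P times on the right. *)
Lemma sum_outdegree_gt_indegree {R : realDomainType} (T : eqType) (s : seq T)
    (r : rel T) (P : nat) (w : T -> R) :
  (forall x, 0 <= w x) ->
  (forall y, y \in s -> (count (r^~ y) s <= P)%N) ->
  (forall x, x \in s -> w x != 0 -> (P < count (r x) s)%N) ->
  \sum_(x <- s) w x <= \sum_(x <- s) \sum_(y <- s | r x y) (w x - w y).
Proof.
move=> w0 hin hout.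
under [leRHS]eq_bigr do rewrite big_split /=.
rewrite big_split /= [X in _ + X](exchange_big_dep predT) //= -big_split /=.
rewrite big_seq_cond [leRHS]big_seq_cond; apply: ler_sum => x /andP[xs _].
rewrite !big_const_seq !iter_addr !addr0.
have [->|wx] := eqVneq (w x) 0.
  by rewrite oppr0 !mul0rn addr0.
rewrite -[w x *+ _]mulr_natr -[(- w x) *+ _]mulr_natr mulNr -mulrBr.
rewrite -[leLHS]mulr1 ler_wpM2l// lerBrDl ?natr1.
have h1 := hin x xs; have h2 := hout x xs wx.
by rewrite ler_nat (leq_ltn_trans h1).
Qed.

Lemma sum_const_le {R : realDomainType} (T : Type) (s : seq T) (p : pred T)
    (c : \bar R) (M : nat) : (0 <= c)%E -> (count p s <= M)%N ->
  (\sum_(y <- s | p y) c <= M%:R%:E * c)%E.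
Proof.
move=> c0 hM.
have -> : (\sum_(y <- s | p y) c = (count p s)%:R%:E * c)%E.
  elim: s {hM} => [|y s IH]; first by rewrite big_nil mul0e.
  rewrite big_cons /= natrD EFinD ge0_muleDl ?lee_fin// -IH.
  by case: ifP; rewrite ?mul1e ?mul0e ?add0e.
by apply: lee_wpmul2r => //; rewrite lee_fin ler_nat.
Qed.

(** * Families of sets with bounded overlap *)

Section integral_overlap.
Local Open Scope ereal_scope.
Context d (T : measurableType d) (R : realType).
Variable m : {measure set T -> \bar R}.
Context (I : eqType).
Implicit Types (s : seq I) (B : I -> set T) (f g : T -> \bar R).

Lemma sum_restrict s B g (z : T) : (forall z, 0 <= g z) ->
  \sum_(i <- s) (g \_ (B i)) z = (count (fun i => z \in B i) s)%:R%:E * g z.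
Proof.
move=> g0; elim: s => [|i s IH]; first by rewrite big_nil /= mul0e.
rewrite big_cons IH /= natrD EFinD ge0_muleDl ?lee_fin ?ler0n//.
by congr (_ + _); rewrite /patch; case: ifP; rewrite ?mul1e ?mul0e.
Qed.

Let measurable_restrictT_sub B g i : (forall i, measurable (B i)) ->
  measurable_fun setT g -> measurable_fun setT (g \_ (B i)).
Proof.
move=> mB mg; apply/(measurable_restrictT g (mB i)).
exact: measurable_funTS.
Qed.

Lemma sum_integral_overlap s B g (N : nat) : (forall i, measurable (B i)) ->
  measurable_fun setT g -> (forall z, 0 <= g z) ->
  (forall z, (count (fun i => z \in B i) s <= N)%N) ->
  \sum_(i <- s) \int[m]_(z in B i) g z <= N%:R%:E * \int[m]_z g z.
Proof.
move=> mB mg g0 hN.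
under eq_bigr do rewrite integral_mkcond.
have mBg i := measurable_restrictT_sub i mB mg.
have Bg0 i z : 0 <= (g \_ (B i)) z by apply: erestrict_ge0.
rewrite -ge0_integral_sum// -ge0_integralZl_EFin ?ler0n//.
apply: ge0_le_integral => //.
- by move=> z _; apply: sume_ge0.
- by apply: emeasurable_sum.
- exact: measurable_funeM.
- move=> z _; rewrite sum_restrict//; apply: lee_wpmul2r => //.
  by rewrite lee_fin ler_nat.
Qed.

Lemma integral_le_cover s B f : (forall i, measurable (B i)) ->
  measurable_fun setT f -> (forall z, 0 <= f z) ->
  (forall z, f z != 0 -> exists2 i, i \in s & B i z) ->
  \int[m]_z f z <= \sum_(i <- s) \int[m]_(z in B i) f z.
Proof.
move=> mB mf f0 cov.
under eq_bigr do rewrite integral_mkcond.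
have mBf i := measurable_restrictT_sub i mB mf.
have Bf0 i z : 0 <= (f \_ (B i)) z by apply: erestrict_ge0.
rewrite -ge0_integral_sum//; apply: ge0_le_integral => //.
- by apply: emeasurable_sum.
- move=> z _; rewrite sum_restrict//.
  have [->|/cov[i si Bi]] := eqVneq (f z) 0; first by rewrite mule0.
  rewrite -[leLHS]mul1e; apply: lee_wpmul2r => //; rewrite lee_fin ler1n -has_count.
  by apply/hasP; exists i => //; rewrite inE.
Qed.

End integral_overlap.

(** * Oscillation of a function around constants *)

Section oscillation.
Local Open Scope ereal_scope.
Context d (T : measurableType d) (R : realType).
Variable m : {measure set T -> \bar R}.
Implicit Types (A B : set T) (u : T -> R) (b c : R).

Let measurable_abs_diff A u c : measurable_fun setT u ->
  measurable_fun A (fun z => `|u z - c|%:E).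
Proof.
move=> mu; apply: measurable_funTS; apply/measurable_EFinP.
by apply: measurableT_comp => //; exact: measurable_funB.
Qed.

(** The pointwise triangle inequality, integrated over [A]. It will compare the means [c] and [c']
    over two overlapping balls. *)
Lemma dist_measure_le_oscillation A B B' u c c' : measurable A -> measurable B ->
  measurable B' -> measurable_fun setT u -> A `<=` B -> A `<=` B' ->
  `|c - c'|%:E * m A <=
    \int[m]_(z in B) `|u z - c|%:E + \int[m]_(z in B') `|u z - c'|%:E.
Proof.
move=> mA mB mB' mu AB AB'; rewrite -integral_cst//.
apply: (@le_trans _ _ (\int[m]_(z in A) (`|u z - c|%:E + `|u z - c'|%:E))).
  apply: ge0_le_integral => //; last 2 first.
  - by apply: emeasurable_funD; exact: measurable_abs_diff.
  - move=> z _ /=; rewrite -EFinD lee_fin.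
    have -> : (c - c' = (u z - c') - (u z - c))%R by lra.
    by apply: (le_trans (ler_normB _ _)); rewrite addrC.
  - by move=> z _; rewrite lee_fin.
rewrite ge0_integralD//; [|exact: measurable_abs_diff..].
by apply: leeD; apply: ge0_subset_integral => //; exact: measurable_abs_diff.
Qed.

Lemma integral_abs_le_oscillation B u c : measurable B -> measurable_fun setT u ->
  \int[m]_(z in B) `|u z|%:E <=
    \int[m]_(z in B) `|u z - c|%:E + `|c|%:E * m B.
Proof.
move=> mB mu; rewrite -integral_cst// -ge0_integralD//=; last first.
  exact: measurable_abs_diff.
apply: ge0_le_integral => //.
- by apply: measurable_funTS; apply/measurable_EFinP; apply: measurableT_comp.
- by apply: emeasurable_funD => //; exact: measurable_abs_diff.
- move=> z _ /=; rewrite -EFinD lee_fin.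
  by rewrite -{1}(subrK c (u z)); exact: ler_normD.
Qed.

(** Turns the Poincare inequality for averages into one for integrals; [b] and [b'] will be the
    measures of a ball and its enlargement. *)
Lemma average_le_cancel (b b' k : R) (x y : \bar R) : (0 < b)%R -> (b <= b')%R ->
  (0 <= k)%R -> 0 <= y ->
  (b^-1)%:E * x <= k%:E * ((b'^-1)%:E * y) -> x <= k%:E * y.
Proof.
move=> b0 bb' k0 y0 h.
have b'0 : (0 < b')%R by exact: lt_le_trans bb'.
have -> : x = b%:E * ((b^-1)%:E * x) by rewrite muleA -EFinM divff ?gt_eqF// mul1e.
apply: (@le_trans _ _ (b%:E * (k%:E * ((b'^-1)%:E * y)))).
  by apply: lee_wpmul2l => //; rewrite lee_fin ltW.
rewrite muleCA; apply: lee_wpmul2l; first by rewrite lee_fin.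
rewrite muleA -EFinM -[leRHS]mul1e; apply: lee_wpmul2r => //.
by rewrite lee_fin ler_pdivrMr// mul1r.
Qed.

End oscillation.

(** * Packing bounds and nets in uniform spaces *)

Section packing.
Context {R : realType} {X : pmetricType R}.
Variable mu : {outer_measure set X -> \bar R}.

Lemma open_mball (x : X) (r : R) : open (ball x r).
Proof.
rewrite openE => y; rewrite ballEmdist /= => xy; apply/nbhs_ballP.
exists (r - mdist x y); first by rewrite /= subr_gt0.
move=> z; rewrite !ballEmdist /= => yz.
by have := metric_triangle x y z; lra.
Qed.

Lemma measurable_mball (x : X) (r : R) : borel_set `<=` mu.-caratheodory ->
  measurable (ball x r : set (caratheodory_type mu)).
Proof. by apply; apply: sub_sigma_algebra; exact: open_mball. Qed.

Definition dist_separated (e : R) (s : seq X) :=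
  uniq s /\ {in s &, forall x y, x != y -> e <= mdist x y}.

(** The balls of radius [e / 2] around the points of [s] are disjoint, have measure at least
    [f (e / 2)], and lie in one ball of measure at most [g (rho + e / 2)]. *)
Lemma packing_bound : metric_measure_space mu -> uniform_space mu ->
  forall e : R, 0 < e -> forall rho : R, 0 < rho -> exists N : nat, forall (s : seq X) (x0 : X),
    dist_separated e s -> {in s, forall x, mdist x0 x < rho} -> (size s <= N)%N.
Proof.
move=> [[cara _] _ _] [f [g [fg0 _ fg]]] e e0 rho rho0.
have e20 : 0 < e / 2 by lra.
have re0 : 0 < rho + e / 2 by lra.
have [f0 _] := fg0 _ e20; have [_ g0] := fg0 _ re0.
exists (Num.truncn (g (rho + e / 2) / f (e / 2))) => s x0 [us sep] sx0.
have b0 : 0 <= g (rho + e / 2) / f (e / 2) by rewrite divr_ge0 ?ltW.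
rewrite truncn_ge_nat// ler_pdivlMr//.
pose T := caratheodory_type mu.
pose m : {measure set T -> \bar R} := (mu : set T -> \bar R).
pose A : set T := ball x0 (rho + e / 2).
have mA : measurable A by exact: measurable_mball.
have mB (x : X) : measurable (ball x (e / 2) : set T) by exact: measurable_mball.
have := @sum_integral_overlap _ T R m X s (fun x => ball x (e / 2))
  (EFin \o \1_A) 1 mB.
rewrite (mul1e _) integral_indic// setIT => sub.
have : (\sum_(x <- s) (f (e / 2))%:E <= (g (rho + e / 2))%:E)%E.
  apply: le_trans (fg x0 _ re0).2; apply: le_trans (sub _ _ _).
  - rewrite big_seq [leRHS]big_seq; apply: lee_sum => x xs.
    rewrite (integral_indic m (mB x) mA) (_ : A `&` _ = ball x (e / 2)).
      exact: (fg x _ e20).1.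
    apply/setIidPr => y; rewrite /A !ballEmdist /= => xy.
    by have := metric_triangle x0 x y; have := sx0 x xs; lra.
  - by apply/measurable_EFinP.
  - by move=> z; rewrite lee_fin.
  - move=> z; apply: uniq_count_le1 => // x y xs ys.
    rewrite !inE !ballEmdist /= => xz yz; apply/eqP; apply/negPn/negP => xy.
    have := sep x y xs ys xy; have := metric_triangle x z y.
    by rewrite (metric_sym z y); lra.
by rewrite sumEFin lee_fin big_const_seq count_predT iter_addr addr0 mulr_natl.
Qed.

Lemma separated_count (e rho : R) (N : nat) (s : seq X) :
  (forall (s : seq X) (x0 : X), dist_separated e s ->
     {in s, forall x, mdist x0 x < rho} -> (size s <= N)%N) ->
  dist_separated e s ->
  forall (p : pred X) (x0 : X), (forall x, x \in s -> p x -> mdist x0 x < rho) ->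
  (count p s <= N)%N.
Proof.
move=> pack [us sep] p x0 hp; rewrite -size_filter; apply: (pack _ x0).
  split=> [|x y]; first exact: filter_uniq.
  by rewrite !mem_filter => /andP[_ xs] /andP[_ ys]; exact: sep.
by move=> x; rewrite mem_filter => /andP[px xs]; exact: hp.
Qed.

(** A separated list of maximal length will do: the packing bound makes the maximum exist, and
    maximality gives the covering. *)
Lemma exists_net (e rho : R) (N : nat) (x0 : X) : 0 < e ->
  (forall (s : seq X) (x0 : X), dist_separated e s ->
     {in s, forall x, mdist x0 x < rho} -> (size s <= N)%N) ->
  exists s, [/\ dist_separated e s, {in s, forall x, mdist x0 x < rho} &
    forall z, mdist x0 z < rho -> exists2 x, x \in s & mdist x z < e].
Proof.
move=> e0 pack.
pose P n := `[< exists s, [/\ dist_separated e s,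
  {in s, forall x, mdist x0 x < rho} & size s = n] >].
have P0 : exists n, P n by exists 0%N; apply/asboolP; exists [::].
have PN n : P n -> (n <= N)%N by move=> /asboolP[s [sep sx0 <-]]; exact: pack sx0.
have [n /asboolP[s [sep sx0 sn]] max] := ex_maxnP P0 PN.
exists s; split=> // z zx0; apply: contrapT => H.
have far x : x \in s -> e <= mdist x z.
  by move=> xs; rewrite leNgt; apply/negP => xz; apply: H; exists x.
have zs : z \notin s.
  by apply/negP => /far; rewrite mdistxx leNgt e0.
have [us sep'] := sep.
suff /max : P n.+1 by rewrite ltnn.
apply/asboolP; exists (z :: s); split; last by rewrite /= sn.
  split=> [|x y]; first by rewrite /= zs.
  rewrite !inE => /orP[/eqP->|xs] /orP[/eqP->|ys]; rewrite ?eqxx// => xy.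
  - by rewrite metric_sym; exact: far.
  - exact: far.
  - exact: sep'.
by move=> x; rewrite inE => /orP[/eqP->|/sx0].
Qed.

End packing.

(** * The net inequality *)

Section net_inequality.
Context {R : realType} {X : pmetricType R}.

(** [K] and [M] are fixed before [rho], so that the Sobolev constant built from them does not depend
    on the support of the function. *)
Lemma net_sum_le_gradient (o : X) (delta C e : R) :
  0 < e -> 0 <= C -> 0 <= delta -> far_children o C ->
  (forall (x x' y : X) h C',
      mdist x y <= h + C' -> mdist x o + h - C' <= mdist y o ->
      mdist x' y <= h + C' -> mdist x' o + h - C' <= mdist y o ->
      mdist x x' <= 4 * C' + 2 * delta) ->
  (forall rho : R, 0 < rho -> exists N : nat, forall (s : seq X) (x0 : X),
    dist_separated e s -> {in s, forall x, mdist x0 x < rho} -> (size s <= N)%N) ->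
  exists (K : R) (M : nat), 0 <= K /\ forall rho : R, 0 < rho ->
  exists (V : seq X) (child : rel X),
    [/\ dist_separated e V,
        forall z, mdist o z < rho -> exists2 x, x \in V & mdist x z < e,
        forall x y, child x y -> mdist x y <= K,
        forall x, (count (child x) V <= M)%N &
        forall a : X -> R, (forall x, a x != 0 -> mdist o x < rho) ->
          \sum_(x <- V) `|a x| <=
          \sum_(x <- V) \sum_(y <- V | child x y) `|a x - a y|].
Proof.
move=> e0 C0 d0 far parents pack.
have [C' CE] : exists C', C' = C + e by exists (C + e).
(* The bound [P] on the number of parents is found before [h], so [P.+1] children can then be
   requested. [C'] exceeds [C] by the cost of moving children to the net. *)
have [|P packP] := pack (4 * C' + 2 * delta + 1); first lra.
have [h h0 far_h] := far P.+1 (2 * e).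
have [|M packM] := pack (h + C' + 1); first lra.
exists (h + C'), M; split; first lra.
(* The larger radius makes the net cover the children of all points where [a] is nonzero. *)
move=> rho rho0; have [|N packN] := pack (rho + h + C); first lra.
have [V [sepV Vrho cov]] := exists_net o e0 packN.
pose child x y := (mdist x y <= h + C') && (mdist x o + h - C' <= mdist y o).
exists V, child; split=> //.
- by move=> z zrho; apply: cov; lra.
- by move=> x y /andP[].
- move=> x; apply: (separated_count packM sepV (x0 := x)) => y _ /andP[xy _]; lra.
move=> a arho; apply: (@le_trans _ _
    (\sum_(x <- V) \sum_(y <- V | child x y) (`|a x| - `|a y|))); last first.
  by apply: ler_sum => x _; apply: ler_sum => y _; exact: lerB_dist.
apply: (@sum_outdegree_gt_indegree _ _ V child P (fun x => `|a x|)) => //.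
- move=> y yV; have [|] := boolP (has (child^~ y) V); last first.
    by rewrite has_count -leqNgt leqn0 => /eqP ->.
  move=> /hasP[x1 x1V /andP[xy1 xy2]].
  apply: (separated_count packP sepV (x0 := x1)) => x _ /andP[xy3 xy4].
  by have := parents _ _ _ _ _ xy1 xy2 xy3 xy4; lra.
move=> x xV; rewrite normr_eq0 => /arho xrho.
have [y [hy sep_y]] := far_h x.
have /choice[y' hy'] : forall j, exists y', (j < P.+1)%N ->
    y' \in V /\ mdist y' (y j) < e.
  move=> j; case: (boolP (j < P.+1)%N) => jP; last by exists o.
  have [xy _] := hy j jP.
  have [|y' y'V y'y] := cov (y j).
    by have := metric_triangle o x (y j); lra.
  by exists y'.
(* The [P.+1] children give as many distinct net points: they are [2 * e] apart and each moves by
   less than [e]. *)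
rewrite -size_filter -(size_iota 0 P.+1) -(size_map y').
apply: uniq_leq_size; last first.
  move=> z /mapP[j]; rewrite mem_iota add0n => /andP[_ jP] ->.
  have [y'V y'y] := hy' j jP; have [h1 h2] := hy j jP.
  rewrite mem_filter y'V andbT; apply/andP.
  have := metric_triangle x (y j) (y' j); have := metric_triangle (y j) (y' j) o.
  by rewrite (metric_sym (y j) (y' j)) CE; split; lra.
rewrite map_inj_in_uniq ?iota_uniq// => i j.
rewrite !mem_iota !add0n => /andP[_ iP] /andP[_ jP] ij.
have far_ij k l : (k < l < P.+1)%N -> y' k <> y' l.
  move=> /andP[kl lP] E; have kP := ltn_trans kl lP.
  have := sep_y k l; rewrite kl lP => /(_ isT).
  have [_ yk] := hy' k kP; have [_ yl] := hy' l lP; rewrite E in yk.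
  have := metric_triangle (y k) (y' l) (y l).
  by rewrite (metric_sym (y k) (y' l)); lra.
have [lt_ij|lt_ji|//] := ltngtP i j.
- by case: (far_ij i j _ ij); rewrite lt_ij.
- by case: (far_ij j i _ (esym ij)); rewrite lt_ji.
Qed.

End net_inequality.

(** * Upper gradients of functions with infinite values *)

(* Nothing is known here about the measurability of [arclength_param]. *)
Section nonmeasurable_integral.
Local Open Scope ereal_scope.
Context d (T : measurableType d) (R : realType).
Variable m : {measure set T -> \bar R}.
Implicit Types (D : set T) (f g : T -> \bar R).

Import HBNNSimple.

(** The integral of a nonnegative function is a supremum over the simple functions below it, which
    is monotone for arbitrary functions. *)
Lemma ge0_le_integral_nonmeasurable D f g : (forall x, 0 <= f x) ->
  (forall x, f x <= g x) -> \int[m]_(x in D) f x <= \int[m]_(x in D) g x.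
Proof.
move=> f0 fg; have g0 x : 0 <= g x by exact: le_trans (f0 x) (fg x).
rewrite !ge0_integralE//; apply: ereal_sup_le => _ [h hf <-].
exists h => // x; apply: le_trans (hf x) _; rewrite /patch.
by case: ifP.
Qed.

Lemma ge0_integralZl_infty D f (k : R) : (forall x, 0 <= f x) -> (0 < k)%R ->
  \int[m]_(x in D) f x = +oo -> \int[m]_(x in D) (k%:E * f x) = +oo.
Proof.
move=> f0 k0 foo.
suff : \int[m]_(x in D) f x <= k^-1%:E * \int[m]_(x in D) (k%:E * f x).
  rewrite foo; case: (\int[m]_(x in D) _) => [r| |]//.
  by rewrite muleC mulNyr gtr0_sg ?invr_gt0// mul1e.
have kf0 x : 0 <= k%:E * f x by rewrite mule_ge0// lee_fin ltW.
rewrite !ge0_integralE//; apply: ge_ereal_sup => _ [h hf <-].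
rewrite muleC lee_pdivlMr// muleC -sintegralrM.
have k0' := ltW k0.
apply: ereal_sup_ubound; exists (scale_nnsfun h k0') => // x.
have := hf x; rewrite /patch /=; case: ifP => _; last first.
  rewrite !lee_fin => hx; rewrite mulr_ge0_le0//.
by move=> hx; rewrite EFinM; apply: lee_wpmul2l.
Qed.

End nonmeasurable_integral.

Section modulus.
Context {R : realType} {X : pmetricType R}.
Variable mu : {outer_measure set X -> \bar R}.
Local Notation T := (caratheodory_type mu).

Lemma borel_fun_measurable (g : X -> \bar R) : borel_set `<=` mu.-caratheodory ->
  borel_fun g -> measurable_fun [set: T] g.
Proof.
move=> cara mg _ Y mY; rewrite setTI; apply: cara.
by have := mg measurableT Y mY; rewrite setTI.
Qed.

Lemma modulus1_eq0P (G : set (rpath X)) : modulus1 mu G = 0%E <->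
  forall e : R, 0 < e -> exists rho, [/\ nonneg_borel rho,
    forall c, G c -> (1 <= line_integral c rho)%E &
    (ointegral mu [set: X] rho <= e%:E)%E].
Proof.
split=> [mod0 e e0|H].
  have : (modulus1 mu G < e%:E)%E by rewrite mod0 lte_fin.
  by move=> /ereal_inf_lt[_ [rho [rho1 rho2] <-] /ltW rho3]; exists rho.
apply/eqP; rewrite eq_le; apply/andP; split.
  apply/lee_addgt0Pr => e e0; rewrite add0e.
  have [rho [rho1 rho2 rho3]] := H e e0.
  by apply: le_trans rho3; apply: ereal_inf_lbound; exists rho.
apply: le_ereal_inf_tmp => _ [rho [[_ rho0] _] <-].
exact: integral_ge0.
Qed.

(** A small multiple of [g] still has infinite integral along the added paths; its sum with a
    function admissible for [G] is admissible for the union. *)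
Lemma modulus1U_infinite (G : set (rpath X)) (g : X -> \bar R) :
  borel_set `<=` mu.-caratheodory -> nonneg_borel g ->
  ointegrable mu [set: X] g -> modulus1 mu G = 0%E ->
  modulus1 mu (G `|` [set c | line_integral c g = +oo%E]) = 0%E.
Proof.
move=> cara [mg g0] ig /modulus1_eq0P modG; apply/modulus1_eq0P => e e0.
have mgT := borel_fun_measurable cara mg.
have [I I0 IE] : exists2 I : R, 0 <= I & ointegral mu [set: X] g = I%:E.
  have h0 : (0 <= ointegral mu [set: X] g)%E by exact: integral_ge0.
  have hfin : (ointegral mu [set: X] g < +oo)%E.
    have [_] := integrableP _ _ _ ig; apply: le_lt_trans.
    by under [leRHS]eq_integral do rewrite gee0_abs//.
  exists (fine (ointegral mu [set: X] g)); first exact: fine_ge0.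
  by rewrite fineK// ge0_fin_numE.
have [|rho [[mrho rho0] rho1 rho2]] := modG (e / 2); first lra.
pose k := e / 2 / (I + 1).
have k0 : 0 < k by rewrite divr_gt0//; lra.
have kI : k * I <= e / 2.
  rewrite /k -mulrA -[leRHS]mulr1 ler_wpM2l//; first lra.
  by rewrite mulrC ler_pdivrMr; lra.
have kg0 x : (0 <= k%:E * g x)%E by rewrite mule_ge0// lee_fin ltW.
exists (fun x => rho x + k%:E * g x)%E; split.
- split; last by move=> x; rewrite adde_ge0.
  apply: emeasurable_funD => //; exact: measurable_funeM.
- move=> c [/rho1 h|/= h].
    apply: le_trans h _; apply: ge0_le_integral_nonmeasurable => // s.
    by rewrite leeDl.
  have := @ge0_integralZl_infty _ _ R lebesgue_measure `[0%R, fine (rlength c)]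
    (fun s => g (arclength_param c s)) k (fun s => g0 _) k0 h => h'.
  apply: (@le_trans _ _ +oo%E); rewrite ?leey// -h'.
  apply: ge0_le_integral_nonmeasurable => // s.
  by rewrite leeDr.
- rewrite /ointegral ge0_integralD//; last 2 first.
  + exact: borel_fun_measurable.
  + exact: measurable_funeM.
  rewrite ge0_integralZl_EFin//; last exact: ltW.
  rewrite -/(ointegral mu _ rho) -/(ointegral mu _ g) IE -EFinM.
  have -> : e = e / 2 + e / 2 by lra.
  by rewrite EFinD; apply: leeD; rewrite ?lee_fin.
Qed.

Lemma weak_upper_gradient_transfer (u v g h : X -> \bar R) :
  borel_set `<=` mu.-caratheodory ->
  nonneg_borel g -> ointegrable mu [set: X] g ->
  (forall c, nonconstant c -> line_integral c g <> +oo%E ->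
     u (c (lo c)) = v (c (lo c)) /\ u (c (hi c)) = v (c (hi c))) ->
  weak_upper_gradient mu u h -> weak_upper_gradient mu v h.
Proof.
move=> cara bg ig uv [bh [G modG hG]]; split => //.
exists (G `|` [set c | line_integral c g = +oo%E]).
  exact: modulus1U_infinite.
move=> c nc /not_orP[nG /= ng]; have [e1 e2] := uv c nc ng.
by rewrite /ug_inequality -e1 -e2; exact: hG.
Qed.

(* Almost every path has endpoints where [u] is finite: the others have infinite
   integral against an integrable upper gradient. *)
Lemma minimal_weak_upper_gradient_fine (u g : X -> \bar R) :
  borel_set `<=` mu.-caratheodory -> newton_sobolev11 mu u ->
  minimal_weak_upper_gradient mu u g ->
  minimal_weak_upper_gradient mu (EFin \o (fine \o u)) g.
Proof.
move=> cara [_ [g0 [bg0 ug0] ig0]] [wg lg ming].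
have endpoints c : nonconstant c -> line_integral c g0 <> +oo%E ->
    u (c (lo c)) = (EFin \o (fine \o u)) (c (lo c)) /\
    u (c (hi c)) = (EFin \o (fine \o u)) (c (hi c)).
  (* An infinite value at an endpoint makes the left-hand side [+oo], even when both values are the
     same infinity. *)
  move=> nc fin; have := ug0 c nc; rewrite /ug_inequality /=.
  case: (u (c (lo c))) => [a| |]; case: (u (c (hi c))) => [b| |] //=;
    by rewrite leye_eq => /eqP.
split=> //; first exact: (weak_upper_gradient_transfer cara bg0 ig0 endpoints wg).
move=> h wh lh; apply: ming => //.
apply: (weak_upper_gradient_transfer cara bg0 ig0 _ wh).
by move=> c nc fin; have [-> ->] := endpoints c nc fin.
Qed.

End modulus.

(** * The Sobolev inequality *)

Section averages.
Context {R : realType} {X : pmetricType R}.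
Variable mu : {outer_measure set X -> \bar R}.
Local Notation T := (caratheodory_type mu).
Local Notation m := ((mu : set T -> \bar R) : {measure set T -> \bar R}).
Implicit Types (u : X -> R) (g : X -> \bar R) (r : R).

Definition mean u r (x : X) : R :=
  fine (average mu (ball x r) (EFin \o u)).

Definition oscillation u r (x : X) : \bar R :=
  ointegral mu (ball x r) (fun y => `|u y - mean u r x|%:E).

Lemma poincare_oscillation (k r r' : R) u g x :
  borel_set `<=` mu.-caratheodory -> 0 <= k -> r <= r' ->
  (0 < mu (ball x r))%E -> (mu (ball x r') < +oo)%E -> (forall y, (0 <= g y)%E) ->
  (average mu (ball x r) (fun y => `|u y - mean u r x|%:E)
     <= k%:E * average mu (ball x r') g)%E ->
  (oscillation u r x <= k%:E * ointegral mu (ball x r') g)%E.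
Proof.
move=> cara k0 rr' mur mur' g0.
have sub : (mu (ball x r) <= mu (ball x r'))%E.
  by apply: le_outer_measure; exact: le_ball.
have fr' : mu (ball x r') \is a fin_num.
  by rewrite ge0_fin_numE.
have fr : mu (ball x r) \is a fin_num.
  by rewrite ge0_fin_numE// (le_lt_trans sub).
apply: average_le_cancel => //.
- by rewrite -lte_fin fineK.
- by rewrite -lee_fin !fineK.
- exact: integral_ge0.
Qed.

Lemma mean_eq0 u r x : (forall y, ball x r y -> u y = 0) -> mean u r x = 0.
Proof.
move=> u0; rewrite /mean /average /ointegral integral0_eq ?mule0// => y xy /=.
by rewrite u0.
Qed.

(** The ball of radius [r / 2] around [x] lies in both balls of radius [r]. *)
Lemma dist_mean_le (k r r' f0 : R) u g x y :
  borel_set `<=` mu.-caratheodory -> measurable_fun [set: T] u -> 0 < r ->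
  (f0%:E <= mu (ball x (r / 2)))%E -> mdist x y <= r / 2 ->
  (oscillation u r x <= k%:E * ointegral mu (ball x r') g)%E ->
  (oscillation u r y <= k%:E * ointegral mu (ball y r') g)%E ->
  (`|mean u r x - mean u r y|%:E * f0%:E <=
   k%:E * ointegral mu (ball x r') g + k%:E * ointegral mu (ball y r') g)%E.
Proof.
move=> cara meas r0 hf xy ox oy.
apply: le_trans (leeD ox oy).
apply: (@le_trans _ _ (`|mean u r x - mean u r y|%:E * mu (ball x (r / 2)))%E).
  by apply: lee_wpmul2l => //; rewrite lee_fin.
apply: (@dist_measure_le_oscillation _ T R m (ball x (r / 2)) (ball x r) (ball y r) u)
  => //; try exact: measurable_mball.
- by apply: le_ball; lra.
- move=> z; rewrite !ballEmdist /= => xz.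
  by have := metric_triangle y x z; rewrite (metric_sym y x); lra.
Qed.

(** Telescoping, at cost [2 * k] per step. [N] stays fixed in the induction on [n], so that one ball
    around [z 0%N] contains all balls of the chain. *)
Lemma dist_mean_chain (k r r' f0 : R) u g (z : nat -> X) (N : nat) :
  borel_set `<=` mu.-caratheodory -> measurable_fun [set: T] u ->
  measurable_fun [set: T] g -> (forall y, (0 <= g y)%E) -> 0 < r -> 0 <= k ->
  (forall x, (f0%:E <= mu (ball x (r / 2)))%E) -> 0 <= f0 ->
  (forall x, (oscillation u r x <= k%:E * ointegral mu (ball x r') g)%E) ->
  (forall i, mdist (z i) (z i.+1) <= r / 2) ->
  forall n, (n <= N)%N ->
  (`|mean u r (z 0%N) - mean u r (z n)|%:E * f0%:E <=
   (n%:R * (2 * k))%:E * ointegral mu (ball (z 0%N) (r' + N%:R * (r / 2))) g)%E.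
Proof.
move=> cara mu_ mg g0 r0 k0 hf f00 osc zs.
have zd n : mdist (z 0%N) (z n) <= n%:R * (r / 2).
  elim: n => [|n IH]; first by rewrite mdistxx mul0r.
  have := metric_triangle (z 0%N) (z n) (z n.+1); have := zs n.
  by rewrite -[n.+1%:R]natr1 mulrDl mul1r; lra.
set G := ointegral mu (ball (z 0%N) _) g.
have G0 : (0 <= G)%E by exact: integral_ge0.
have GN n : (n <= N)%N -> (ointegral mu (ball (z n) r') g <= G)%E.
  move=> nN; apply: ge0_subset_integral => //; try exact: measurable_mball.
    exact: measurable_funTS.
  move=> y; rewrite !ballEmdist /= => h.
  have := metric_triangle (z 0%N) (z n) y; have := zd n.
  have : n%:R * (r / 2) <= N%:R * (r / 2) by rewrite ler_wpM2r ?ler_nat//; lra.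
  lra.
elim=> [|n IH] nN; first by rewrite subrr normr0 mul0e mul0r mul0e.
have := dist_mean_le cara mu_ r0 (hf (z n)) (zs n) (osc _) (osc _).
move=> step.
apply: (@le_trans _ _ (`|mean u r (z 0%N) - mean u r (z n)|%:E * f0%:E +
    `|mean u r (z n) - mean u r (z n.+1)|%:E * f0%:E)%E).
  rewrite -!EFinM -EFinD lee_fin -mulrDl ler_wpM2r//.
  exact: ler_distD.
rewrite -[n.+1%:R]natr1 mulrDl mul1r EFinD ge0_muleDl ?lee_fin; last 2 first.
  by apply: mulr_ge0 => //; lra.
  by lra.
apply: leeD; first exact: IH (ltnW nN).
apply: le_trans step _.
have -> : 2 * k = k + k by lra.
rewrite EFinD ge0_muleDl ?lee_fin//.
by apply: leeD; apply: lee_wpmul2l; rewrite ?lee_fin//; apply: GN => //; exact: ltnW.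
Qed.

End averages.

Section sobolev.
Context {R : realType} {X : pmetricType R}.
Variable mu : {outer_measure set X -> \bar R}.
Local Notation T := (caratheodory_type mu).
Local Notation m := ((mu : set T -> \bar R) : {measure set T -> \bar R}).

Lemma ointegrable_fine (u : X -> \bar R) : ointegrable mu [set: X] u ->
  ointegrable mu [set: X] (EFin \o (fine \o u)).
Proof.
move=> iu; apply: (le_integrable _ _ _ iu) => //.
  apply/measurable_EFinP; apply: measurableT_comp => //.
  exact: measurable_int iu.
by move=> x _ /=; case: (u x) => [a| |] //=; rewrite normr0 leey.
Qed.

Lemma ointegral_abs_fine (u : X -> \bar R) : ointegrable mu [set: X] u ->
  ointegral mu [set: X] (fun x => `|u x|%E) =
  ointegral mu [set: X] (fun x => `|fine (u x)|%:E).
Proof.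
move=> iu; have mu_ := measurable_int _ iu.
apply: ae_eq_integral => //.
- exact: measurableT_comp.
- apply/measurable_EFinP; apply: measurableT_comp => //.
  exact: measurableT_comp.
have := integrable_ae measurableT iu; apply: filterS => x fin _ /=.
by rewrite -{1}(fineK (fin I)).
Qed.

Lemma net_sobolev (o : X) :
  metric_measure_space mu -> uniform_space mu -> local_weak_poincare11 mu ->
  quasiconvex X ->
  (forall e : R, 0 < e -> exists (K : R) (M : nat), 0 <= K /\
    forall rho : R, 0 < rho -> exists (V : seq X) (child : rel X),
    [/\ dist_separated e V,
        forall z, mdist o z < rho -> exists2 x, x \in V & mdist x z < e,
        forall x y, child x y -> mdist x y <= K,
        forall x, (count (child x) V <= M)%N &
        forall a : X -> R, (forall x, a x != 0 -> mdist o x < rho) ->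
          \sum_(x <- V) `|a x| <=
          \sum_(x <- V) \sum_(y <- V | child x y) `|a x - a y|]) ->
  sobolev11 mu.
Proof.
move=> mm us [C [r [tau [C0 r0 tau1 poin]]]] qc nets.
have [[cara _] _ finite_balls] := mm.
have [f [fg [fg0 _ mu_fg]]] := us.
have r20 : 0 < r / 2 by lra.
have [f0 _] := fg0 _ r20; have [_ fgr0] := fg0 _ r0.
have [K [M [K0 net]]] := nets _ r20.
have [Q Q1 chain] := quasiconvex_chain qc.
have pack := packing_bound mm us r20.
have tr0 : 0 < tau * r by apply: mulr_gt0 => //; lra.
have rtr : r <= tau * r by rewrite ler_peMl// ltW.
(* A chain of [n.+1] steps of length at most [r / 2] will join any parent to its child; [rho2] is
   the radius of a ball containing the enlarged balls along it. *)
have [n nK] : exists n : nat, Q * K <= n%:R * (r / 2).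
  exists (Num.truncn (Q * K / (r / 2))).+1.
  by rewrite -ler_pdivrMr// ltW// truncnS_gt.
have [rho2 rho2E] : exists rho2, rho2 = tau * r + n.+1%:R * (r / 2).
  by eexists; reflexivity.
have rho20 : 0 < rho2 by rewrite rho2E addr_gt0// mulr_gt0.
have [N1 pack1] := pack _ tr0; have [N2 pack2] := pack _ rho20.
have [C1 C1E C10] : exists2 C1, C1 = C * r & 0 <= C1.
  by exists (C * r) => //; rewrite mulr_ge0 ?ltW.
have [C2 C2E C20] : exists2 C2, C2 = n.+1%:R * (2 * C1) & 0 <= C2.
  by exists (n.+1%:R * (2 * C1)) => //; rewrite mulr_ge0// mulr_ge0.
(* [M] children per net point, [C2] per chain and overlap [N2]; [f (r / 2)] comes from comparing
   means, [fg r] from the measure of balls of radius [r]. *)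
pose C3 := fg r / f (r / 2) * (M%:R * C2 * N2%:R).
have C30 : 0 <= C3.
  apply: mulr_ge0; first by apply: divr_ge0; exact: ltW.
  by apply: mulr_ge0 => //; apply: mulr_ge0.
have C1N : 0 <= C1 * N1%:R by rewrite mulr_ge0.
exists (C1 * N1%:R + C3 + 1); first lra.
move=> u g nu [x0 [R0 supp]] ming.
have iu := nu.1; rewrite ointegral_abs_fine//.
(* The Poincare inequality is for real-valued functions; [u] is finite almost everywhere. *)
pose v : X -> R := fine \o u.
have iv := ointegrable_fine iu.
have mv : measurable_fun [set: T] v by apply/measurable_EFinP; exact: measurable_int iv.
have minv := minimal_weak_upper_gradient_fine cara nu ming.
have [[[bg g0] _] _ _] := ming.
have mg := borel_fun_measurable cara bg.
set I := ointegral mu [set: X] g.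
have I0 : (0 <= I)%E by exact: integral_ge0.
have mB (x : X) s : measurable (ball x s : set T) by exact: measurable_mball.
have fmu (x : X) : ((f (r / 2))%:E <= mu (ball x (r / 2)))%E := (mu_fg x _ r20).1.
have osc x : (oscillation mu v r x <= C1%:E * ointegral mu (ball x (tau * r)) g)%E.
  rewrite C1E; have [|_ hx] := poin x r; first by rewrite r0 lexx.
  apply: poincare_oscillation => //.
  - by rewrite -C1E.
  - have [h _] := mu_fg x _ r0; apply: lt_le_trans h; rewrite lte_fin.
    exact: (fg0 _ r0).1.
  - exact: finite_balls.
  - apply: hx => //; apply: integrableS iv => //.
have mean_grad x y : mdist x y <= K ->
    (`|mean mu v r x - mean mu v r y|%:E * (f (r / 2))%:E <=
     C2%:E * ointegral mu (ball x rho2) g)%E.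
  move=> xy; have [|z [z0 zn zs]] := chain x y _ n r20.
    by apply: le_trans nK; rewrite ler_wpM2l//; lra.
  have := dist_mean_chain (N := n.+1) cara mv mg g0 r0 C10 fmu (ltW f0) osc zs
    (leqnn _).
  by rewrite z0 zn// -rho2E -C2E.
(* [R0] may be negative, hence the absolute value. The summand [r] makes the means vanish at centres
   outside [ball o rho]. *)
pose rho := `|R0| + mdist o x0 + r + 1.
have rho0 : 0 < rho.
  by have := normr_ge0 R0; have := mdist_ge0 o x0; rewrite /rho; lra.
have v_supp y : v y != 0 -> mdist o y < rho - r.
  move=> vy; have : ball x0 R0 y.
    apply: supp; apply: subset_closure => /=; apply: contraNneq vy.
    by rewrite /v /= => ->.
  rewrite ballEmdist /= => h; have := metric_triangle o x0 y; have := ler_norm R0.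
  by rewrite /rho; lra.
have [V [child [sepV covV childK childM sumV]]] := net rho rho0.
have sum_mean : ((\sum_(x <- V) `|mean mu v r x|)%:E * (f (r / 2))%:E <=
    (M%:R * C2 * N2%:R)%:E * I)%E.
  apply: (@le_trans _ _ ((\sum_(x <- V) \sum_(y <- V | child x y)
      `|mean mu v r x - mean mu v r y|)%:E * (f (r / 2))%:E)%E).
    apply: lee_wpmul2r; first by rewrite lee_fin ltW.
    rewrite lee_fin; apply: sumV => x ax.
    apply: contrapT => /negP; rewrite -leNgt => xrho; move/eqP: ax; apply.
    apply: mean_eq0 => y; rewrite ballEmdist /= => xy; apply/eqP; apply/negPn/negP.
    move=> /v_supp yrho; have := metric_triangle o y x.
    by rewrite (metric_sym y x); lra.
  apply: (@le_trans _ _ (\sum_(x <- V)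
      (M%:R * C2)%:E * ointegral mu (ball x rho2) g)%E).
    rewrite -EFinM mulr_suml -sumEFin; apply: lee_sum => x _.
    rewrite mulr_suml -sumEFin.
    apply: (@le_trans _ _ (\sum_(y <- V | child x y)
        C2%:E * ointegral mu (ball x rho2) g)%E).
      by apply: lee_sum => y xy; rewrite EFinM; exact: mean_grad (childK _ _ xy).
    have G0 : (0 <= ointegral mu (ball x rho2) g)%E by exact: integral_ge0.
    rewrite EFinM -muleA; apply: sum_const_le => //.
    by rewrite mule_ge0// lee_fin.
  rewrite -ge0_sume_distrr; last by move=> x _; exact: integral_ge0.
  rewrite [in leRHS]EFinM -muleA; apply: lee_wpmul2l.
    by rewrite lee_fin mulr_ge0.
  apply: (@sum_integral_overlap _ T R m X V (fun x => ball x rho2)) => // z.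
  apply: (separated_count pack2 sepV (x0 := z)) => x _.
  by rewrite inE ballEmdist /= metric_sym.
have cover : (ointegral mu [set: X] (fun x => `|v x|%:E) <=
   \sum_(x <- V) ointegral mu (ball x r) (fun x => `|v x|%:E))%E.
  apply: (@integral_le_cover _ T R m X V (fun x => ball x r)) => //.
  - by apply/measurable_EFinP; apply: measurableT_comp.
  - move=> z; rewrite eqe normr_eq0 => /v_supp zrho.
    have [|x xV xz] := covV z; first lra.
    by exists x => //; rewrite ballEmdist /=; lra.
apply: (le_trans cover).
(* On each ball, [v] is split into its deviation from the mean, controlled by [osc], and the mean,
   controlled by [sum_mean]. *)
have step x : (ointegral mu (ball x r) (fun y => `|v y|%:E) <=
    C1%:E * ointegral mu (ball x (tau * r)) g + (`|mean mu v r x| * fg r)%:E)%E.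
  apply: le_trans (@integral_abs_le_oscillation _ T R m _ v
    (mean mu v r x) (mB x r) mv) _.
  apply: leeD; first exact: osc.
  by rewrite EFinM; apply: lee_wpmul2l; [rewrite lee_fin|exact: (mu_fg x _ r0).2].
apply: (le_trans (lee_sum _ (fun x _ => step x))).
rewrite big_split /= sumEFin -mulr_suml -ge0_sume_distrr; last first.
  by move=> x _; exact: integral_ge0.
have overlap1 : (\sum_(x <- V) ointegral mu (ball x (tau * r)) g <= N1%:R%:E * I)%E.
  apply: (@sum_integral_overlap _ T R m X V (fun x => ball x (tau * r))) => // z.
  apply: (separated_count pack1 sepV (x0 := z)) => x _.
  by rewrite inE ballEmdist /= metric_sym.
apply: (@le_trans _ _ ((C1 * N1%:R)%:E * I + C3%:E * I)%E); last first.
  rewrite -ge0_muleDl ?lee_fin// -EFinD; apply: lee_wpmul2r => //.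
  by rewrite lee_fin; lra.
apply: leeD.
  by rewrite [in leRHS]EFinM -muleA; apply: lee_wpmul2l; rewrite ?lee_fin.
set S := \sum_(x <- V) _ in sum_mean *.
have -> : S * fg r = fg r / f (r / 2) * (S * f (r / 2)).
  by rewrite mulrCA -mulrA mulVf ?gt_eqF// mulr1.
rewrite /C3 EFinM [in leRHS]EFinM -muleA; apply: lee_wpmul2l.
  by rewrite lee_fin divr_ge0 ?ltW.
by rewrite EFinM.
Qed.

End sobolev.

Theorem theoremE (R : realType) (X : pmetricType R)
    (mu : {outer_measure set X -> \bar R}) (o : X) :
  metric_measure_space mu ->
  quasiconvex X ->
  uniform_space mu ->
  gromov_hyperbolic X ->
  visual X ->
  local_weak_poincare11 mu ->
  connected [set: gboundary o] ->
  (exists xi eta : gboundary o, xi <> eta) ->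
  sobolev11 mu.
Proof.
move=> mm qc us hyp vis poin conn two.
have [delta [C [d0 C0 far par]]] := hyperbolic_children hyp qc vis conn two.
apply: (net_sobolev (o := o) mm us poin qc) => e e0.
exact: (net_sum_le_gradient e0 C0 d0 far par (packing_bound mm us e0)).
Qed.
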